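(* Let $\iota\in\mathbb{R}^n$ be a unit vector and let $X=n^{1/2}\iota\mu'+E$ be an $n\times p$ random matrix, where $E$ has i.i.d. rows from $\mathcal{N}(0,\Sigma)$ for a $p\times p$ covariance matrix $\Sigma$. Suppose that $\mathcal{S}$ is an oracle subgroup, i.e. a compact group of orthonormal $n\times n$ matrices with $\iota'S\iota=0$ for all $S\in\mathcal{S}\setminus\{I\}$. Let $\mu\in\mathbb{R}^p$ have $k\ge1$ positive elements, indexed $\mu_1,\dots,\mu_k$, and let the remaining elements be equal to zero. Let $\alpha\in[0,1]$. Let $Z\sim\mathcal{N}(n^{1/2}\mu,\Sigma)$, and let $Y$ have i.i.d. rows from $\mathcal{N}(0,\Sigma)$, independent of $Z$. Then the power of the $\mathcal{S}$-based maxT method at level $\alpha$ is $$\frac{1}{k}\sum_{j=1}^k\mathbb{P}\left[Z_j>q_\alpha^{|\mathcal{S}|}\left(\max_{1\le l\le p}Y_l\right)\right],$$ where $q_\alpha^{|\mathcal{S}|}(\max_{1\le l\le p}Y_l)$ denotes the $\alpha$ sample upper-quantile based on $|\mathcal{S}|-1$ draws of $\max_{1\le l\le p}Y_l$ (one from each of $|\mathcal{S}|-1$ i.i.d. rows of $Y$), and the probability is over both $Z$ and these draws.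
   Context: A prime denotes transposition; $I$ is the identity matrix. The hypotheses tested are $H_0^j:\mu_j=0$ against $H_1^j:\mu_j>0$, $j=1,\dots,p$. The $\mathcal{S}$-based maxT method at level $\alpha$: let $\overline{S}$ be uniformly distributed on $\mathcal{S}$, independent of $X$, and let $X_j$ be the $j$th column of $X$. The method rejects $H_0^j$ if and only if $$\mathbb{P}_{\overline{S}}\left[\iota'X_j\le\max_{1\le i\le p}\iota'\overline{S}X_i\right]\le\alpha,$$ where the probability is over $\overline{S}$ only, with $X$ held fixed. (An oracle subgroup is automatically finite.) The power is the expected proportion of correctly rejected hypotheses, i.e. $\frac1k\sum_{j=1}^k\mathbb{P}[H_0^j\text{ is rejected}]$, where $\mu_1,\dots,\mu_k$ are the positive elements of $\mu$. Sample upper-quantile: given $|\mathcal{S}|-1$ real draws, $q_\alpha^{|\mathcal{S}|}$ is the $m$th largest of these draws with $m=\lfloor\alpha|\mathcal{S}|\rfloor$, with the conventions $q_\alpha^{|\mathcal{S}|}=+\infty$ if $m=0$ and $q_\alpha^{|\mathcal{S}|}=-\infty$ if $m=|\mathcal{S}|$. *)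

(* Defs.v *)
From HB Require Import structures.
From mathcomp Require Import all_boot all_order all_algebra finmap.
From mathcomp Require Import all_classical all_reals all_analysis.

Set Implicit Arguments.
Unset Strict Implicit.
Unset Printing Implicit Defensive.

Import Order.TTheory GRing.Theory Num.Theory.
Import numFieldNormedType.Exports.

Local Open Scope classical_set_scope.
Local Open Scope ring_scope.

(* The product sigma-algebra on matrices (for 'M[R]_(m, n) with R : realType,
   the Borel sets), as the library does for tuples. *)
Definition mx_coordinate_sets d (T : sigmaRingType d) m n :
    set_system 'M[T]_(m, n) :=
  \bigcup_(ij in [set: 'I_m * 'I_n])
    preimage_set_system setT (fun M : 'M[T]_(m, n) => M ij.1 ij.2) measurable.

Definition measure_matrix_display : measure_display -> measure_display.
Proof. exact. Qed.

Section measurable_matrix.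
Context {d} {T : sigmaRingType d}.
Variables m n : nat.

Let G := @mx_coordinate_sets d T m n.

Let matrix_set0 : <<s G >> set0.
Proof. exact: sigma_algebra0. Qed.

Let matrix_setC A : <<s G >> A -> <<s G >> (~` A).
Proof. exact: sigma_algebraC. Qed.

Let matrix_bigcup (F : (set 'M[T]_(m, n))^nat) :
  (forall i, <<s G >> (F i)) -> <<s G >> (\bigcup_i F i).
Proof. exact: sigma_algebra_bigcup. Qed.

HB.instance Definition _ := @isMeasurable.Build (measure_matrix_display d)
  'M[T]_(m, n) <<s G >> matrix_set0 matrix_setC matrix_bigcup.

End measurable_matrix.

Section random_vectors.
Context d (T : measurableType d) (R : realType) (P : probability T R).

(* The product rule over the whole finite family contains the one over each
   subfamily, since any B i may be setT. *)
Definition mutually_independent (I : finType) d' (U : measurableType d')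
    (V : I -> T -> U) : Prop :=
  forall B : I -> set U, (forall i, measurable (B i)) ->
    P (\bigcap_(i in [set: I]) (V i @^-1` B i))
    = (\prod_(i : I) P (V i @^-1` B i))%E.

Definition independent d1 (U1 : measurableType d1) d2 (U2 : measurableType d2)
    (V1 : T -> U1) (V2 : T -> U2) : Prop :=
  forall B1 B2, measurable B1 -> measurable B2 ->
    P (V1 @^-1` B1 `&` V2 @^-1` B2) = (P (V1 @^-1` B1) * P (V2 @^-1` B2))%E.

End random_vectors.

Definition standard_normal_family d (T : measurableType d) (R : realType)
    (P : probability T R) (I : finType) (W : I -> {RV P >-> R}) : Prop :=
  mutually_independent P (fun i => W i : T -> R) /\
  forall i (B : set R), measurable B -> distribution P (W i) B = normal_prob 0 1 B.

(* V ~ N(m, Sigma): V has the law of m + A W, where A A' = Sigma and the entries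
   of W are i.i.d. standard normal. Sigma may be singular, so there is no
   density in general; W may live on another probability space. *)
Definition multivariate_normal d (T : measurableType d) (R : realType)
    (P : probability T R) p (V : T -> 'cV[R]_p) (m : 'cV[R]_p)
    (Sigma : 'M[R]_p) : Prop :=
  exists d' (T' : measurableType d') (Q : probability T' R)
    (W : 'I_p -> {RV Q >-> R}) (A : 'M[R]_p),
    [/\ standard_normal_family W,
        A *m A^T = Sigma &
        forall B : set 'cV[R]_p, measurable B ->
          P (V @^-1` B)
          = Q ((fun w => m + A *m (\col_i W i w)) @^-1` B)].

Definition iid_normal_rows d (T : measurableType d) (R : realType)
    (P : probability T R) n p (E : T -> 'M[R]_(n, p)) (Sigma : 'M[R]_p) : Prop :=
  mutually_independent P (fun i w => row i (E w)) /\
  forall i, multivariate_normal P (fun w => (row i (E w))^T) 0 Sigma.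

Definition covariance_matrix (R : realType) p (Sigma : 'M[R]_p) : Prop :=
  Sigma^T = Sigma /\ forall v : 'cV[R]_p, 0 <= (v^T *m Sigma *m v) 0 0.

(* A group of orthonormal matrices: the inverse of S is S^T. *)
Definition oracle_subgroup (R : realType) n (iota : 'cV[R]_n)
    (G : set 'M[R]_n) : Prop :=
  [/\ forall S, G S -> S^T *m S = 1%:M,
      [/\ G 1%:M, forall S1 S2, G S1 -> G S2 -> G (S1 *m S2)
        & forall S, G S -> G S^T],
      compact G
    & forall S, G S -> S <> 1%:M -> (iota^T *m S *m iota) 0 0 = 0].

(* 0 on infinite sets; an oracle subgroup is finite (oracle_subgroup_finite). *)
Definition cardset (T : choiceType) (A : set T) : nat := #|` fset_set A|.

(* P[Sbar \in A] for Sbar uniformly distributed on the finite set G. *)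
Definition uniform_on (R : realType) (T : choiceType) (G A : set T) : R :=
  (cardset (G `&` A))%:R / (cardset G)%:R.

(* The maxima are taken in \bar R to have a unit for max, so that no
   index has to be singled out. *)
Definition maxT_rejects (R : realType) n p (iota : 'cV[R]_n)
    (G : set 'M[R]_n) (alpha : R) (X : 'M[R]_(n, p)) (j : 'I_p) : Prop :=
  uniform_on R G [set S |
    (((iota^T *m X) 0 j)%:E
     <= \big[maxe/-oo]_(i < p) ((iota^T *m S *m X) 0 i)%:E)%E] <= alpha.

Definition maxT_power d (T : measurableType d) (R : realType)
    (P : probability T R) n p (iota : 'cV[R]_n) (G : set 'M[R]_n) (alpha : R)
    (mu : 'cV[R]_p) (X : T -> 'M[R]_(n, p)) : \bar R :=
  ((#|[set j | (0 < mu j 0)%R]|%:R^-1)%:E *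
   \sum_(j < p | (0 < mu j 0)%R)
     P [set w | maxT_rejects iota G alpha (X w) j])%E.

(* The alpha sample upper-quantile of N - 1 draws: their m-th largest (counted
   with multiplicity), m being the integer part of alpha N. *)
Definition upper_quantile (R : realType) (alpha : R) (N : nat)
    (draw : 'I_N.-1 -> \bar R) : \bar R :=
  let m := Num.truncn (alpha * N%:R) in
  if m == 0%N then +oo%E
  else if m == N then -oo%E
  else nth -oo%E (sort (fun x y => (y <= x)%E) [seq draw i | i <- enum 'I_N.-1])
         m.-1.

Lemma oracle_subgroup_finite (R : realType) n (iota : 'cV[R]_n)
    (G : set 'M[R]_n) :
  (iota^T *m iota) 0 0 = 1 -> oracle_subgroup iota G -> finite_set G.
Proof.
move=> iota1 [orthG [_ mulG trG] _ oracleG]; apply: contrapT => infG.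
have [B BG Bn] := infinite_set_fset n.+1 infG.
pose S (i : 'I_n.+1) : 'M[R]_n := nth 0 (enum_fset B) i.
have SB i : S i \in B by apply: mem_nth; apply: leq_trans Bn; exact: ltn_ord.
have SG i : G (S i) by apply: BG; exact: SB.
pose M : 'M[R]_(n.+1, n) := \matrix_i (iota^T *m S i).
have MMT : M *m M^T = 1%:M.
  apply/matrixP => i j; rewrite !mxE.
  have -> : \sum_k M i k * M^T k j = (iota^T *m (S i *m (S j)^T) *m iota) 0 0.
    have -> : iota^T *m (S i *m (S j)^T) *m iota
              = (iota^T *m S i) *m (iota^T *m S j)^T.
      by rewrite trmx_mul trmxK !mulmxA.
    rewrite mxE; apply: eq_bigr => k _.
    by rewrite ![M^T _ _]mxE ![M _ _]mxE ![(iota^T *m S j)^T _ _]mxE.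
  have [<-|ij] := eqVneq i j.
    by rewrite (mulmx1C (orthG _ (SG i))) mulmx1.
  apply: oracleG; first by apply: mulG => //; exact: trG.
  move=> Sij; have /eqP : S i = S j.
    by rewrite -[LHS]mulmx1 -(orthG _ (SG j)) mulmxA Sij mul1mx.
  rewrite nth_uniq ?fset_uniq//; last 2 first.
  - by apply: leq_trans Bn; exact: ltn_ord.
  - by apply: leq_trans Bn; exact: ltn_ord.
  by move=> /eqP/val_inj /eqP; rewrite (negbTE ij).
have := leq_trans (mxrankM_maxl M M^T) (rank_leq_col M).
by rewrite MMT mxrank1 ltnn.
Qed.

(* Main.v *)
Require Import Defs.
From HB Require Import structures.
From mathcomp Require Import all_boot all_order all_algebra finmap.
From mathcomp Require Import all_classical all_reals all_analysis.
From mathcomp Require Import measurable_realfun.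
From mathcomp Require Import ring lra.

(** Let M be the matrix whose rows are iota' S for S in the group, the identity
    coming first. For distinct S1, S2 in the group, iota' S1 S2' iota = 0
    because S1 S2' is an element other than the identity; so M has orthonormal
    rows, and M iota is the first basis vector. Hence M X is M E with
    sqrt n * mu' added to its first row, and the decision on the j-th hypothesis
    depends on M X only: it compares the j-th entry of the first row with the
    maxima of the rows of M X.

    Multiplying E by a matrix with orthonormal rows gives again i.i.d. N(0, Sigma)
    rows [iid_normal_rows_semiorthogonal]. So M X has the law of Z stacked on
    the independent rows of Y [iid_normal_rows_col_mx]. The identity always
    counts among the S with iota' X_j <= max_i iota' S X_i, so rejection means
    that one plus the number of other rows whose maximum reaches the j-th entry
    of the first row is at most alpha |G|. By the definition of the sample
    quantile, that says that this entry exceeds it [upper_quantile_lt].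

    The probabilistic input is that the law of A W, for W standard normal,
    depends only on A A' [gaussian_law_of_gram]. Shears preserve area, by
    Fubini and translation invariance, and a rotation of the plane is a product
    of three shears; since the normal density of the plane is a function of
    x^2 + y^2, rotations preserve it [normal_prob_rotation]. By independence,
    rotations in two coordinates preserve the standard normal law in any
    dimension, and so do sign changes. Rotations move any vector to a coordinate
    axis, so conjugating a sign change yields every Householder reflection
    [gaussian_isometry_householder]. Finally, if A A' = B B', reflecting in
    a - b for the successive pairs of rows (a, b) turns A into B: the equality
    of the Gram matrices makes a - b orthogonal to the rows that agree already,
    which the reflection therefore fixes [gram_isometry]. No density of
    N(0, Sigma) is involved, so Sigma may be singular. *)
Set Implicit Arguments.
Unset Strict Implicit.
Unset Printing Implicit Defensive.

Import Order.TTheory GRing.Theory Num.Theory.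
Import numFieldNormedType.Exports.

Local Open Scope classical_set_scope.
Local Open Scope ring_scope.

(** * Laws determined by a generating system of sets *)

(** Both sides are finite measures in C, so it suffices to compare them on a
    generating system stable under intersection. *)
Lemma indep_generator d (T : measurableType d) (R : realType)
    (P : probability T R) d' (U : measurableType d')
    (Q : {measure set U -> \bar R}) (H : set_system U) (V : T -> U) (F : set T) :
  measurable = <<s H >> -> setI_closed H -> H setT ->
  measurable_fun setT V -> measurable F ->
  (forall C, H C -> P (F `&` V @^-1` C) = (P F * Q C)%E) ->
  forall C, measurable C -> P (F `&` V @^-1` C) = (P F * Q C)%E.
Proof.
move=> mH HI HT mV mF eqH C mC.
have PF0 : (0 <= fine (P F))%R by rewrite fine_ge0// measure_ge0.
pose r := NngNum PF0.
have rE : (r%:num)%:E = P F by rewrite /= fineK// fin_num_measure.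
pose m1 := pushforward (mrestr P mF) V.
have m1E D : m1 D = P (F `&` V @^-1` D).
  by rewrite /m1 /pushforward /mrestr setIC.
have mV' := isMeasurableFun.Build _ _ _ _ _ mV.
pose V' : {mfun T >-> U} := HB.pack V mV'.
have m2E D : mscale r Q D = (P F * Q D)%E by rewrite /mscale rE.
rewrite -m1E -[RHS]m2E.
apply: (@measure_unique _ _ _ H (fun=> setT) mH HI (fun=> HT) _
  (pushforward (mrestr P mF) V') (mscale r Q)) => //.
- by rewrite bigcup_const.
- by move=> D HD; rewrite -[LHS]/(m1 D) -[RHS]/(mscale r Q D) m1E m2E eqH.
- move=> _; rewrite -[X in (X < _)%E]/(m1 setT) m1E preimage_setT setIT.
  by rewrite -ge0_fin_numE// fin_num_measure.
Qed.

Lemma mutually_independent_generator d (T : measurableType d) (R : realType)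
    (P : probability T R) (I : finType) d' (U : measurableType d')
    (V : I -> T -> U) (H : set_system U) :
  measurable = <<s H >> -> setI_closed H -> H setT ->
  (forall i, measurable_fun setT (V i)) ->
  (forall B : I -> set U, (forall i, H (B i)) ->
     P (\bigcap_(i in [set: I]) (V i @^-1` B i))
     = (\prod_(i : I) P (V i @^-1` B i))%E) ->
  mutually_independent P V.
Proof.
move=> mH HI HT mV indH.
have subH : H `<=` measurable by rewrite mH; exact: sub_gen_smallest.
have mVB i C : measurable C -> measurable (V i @^-1` C).
  by move=> mC; rewrite -[X in measurable X]setTI; exact: mV.
(* the events are generalized one index at a time: s lists the indices whose
   event is an arbitrary measurable set, the others staying in H *)
suff ind (s : seq I) (B : I -> set U) :
    (forall i, i \in s -> measurable (B i)) ->
    (forall i, i \notin s -> H (B i)) ->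
    P (\bigcap_(i in [set: I]) (V i @^-1` B i))
    = (\prod_(i : I) P (V i @^-1` B i))%E.
  move=> B mB; apply: (ind (enum I)) => // i.
  by rewrite mem_enum.
elim: s B => [|x s IH] B mB HB; first by apply: indH => i; exact: HB.
have mB' i : measurable (B i).
  by have [/mB//|/HB/subH] := boolP (i \in x :: s).
pose F := \bigcap_(i in [set~ x]) (V i @^-1` B i).
have mF : measurable F.
  by apply: fin_bigcap_measurable => // i _; exact: mVB.
pose Bx C i := if i == x then C else B i.
have FC C : F `&` V x @^-1` C = \bigcap_(i in [set: I]) (V i @^-1` Bx C i).
  apply/seteqP; split => [w [Fw Vw] i _|w Fw].
    by rewrite /Bx; case: eqP => [->//|/Fw].
  split; last by have := Fw x Logic.I; rewrite /Bx eqxx.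
  by move=> i /eqP/negbTE ix; have := Fw i Logic.I; rewrite /Bx ix.
(* C := setT identifies P F, so step is the independence hypothesis required
   by indep_generator *)
have step C : H C ->
    P (F `&` V x @^-1` C)
    = (P (V x @^-1` C) * \prod_(i | i != x) P (V i @^-1` B i))%E.
  move=> HC; rewrite FC IH.
  - rewrite (bigD1 x)//= /Bx eqxx; congr (_ * _)%E.
    by apply: eq_bigr => i /negbTE ->.
  - by move=> i _; rewrite /Bx; case: eqP => [_|_]; [exact: subH|exact: mB'].
  - move=> i ins; rewrite /Bx; case: eqP => [//|/eqP ix].
    by apply: HB; rewrite in_cons negb_or ix.
have PF : P F = (\prod_(i | i != x) P (V i @^-1` B i))%E.
  by have := step _ HT; rewrite !preimage_setT setIT probability_setT mul1e.
have mV' := isMeasurableFun.Build _ _ _ _ _ (mV x).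
pose V' : {mfun T >-> U} := HB.pack (V x) mV'.
have := @indep_generator _ _ _ P _ _ (distribution P V') _ _ _ mH HI HT (mV x) mF.
move=> /(_ _ (B x) (mB' x)) indx.
rewrite (_ : \bigcap_(i in [set: I]) (V i @^-1` B i) = F `&` V x @^-1` B x).
  rewrite indx; last by move=> C HC; rewrite step// muleC PF.
  by rewrite PF [RHS](bigD1 x)//= [RHS]muleC.
rewrite FC; apply: eq_bigcapr => i _.
by rewrite /Bx; case: eqP => // ->.
Qed.

(** * Random matrices *)

Definition mx_rectangles (R : realType) m n : set_system 'M[R]_(m, n) :=
  [set C | exists B : 'I_m -> 'I_n -> set R,
     (forall i j, measurable (B i j)) /\
     C = [set M : 'M[R]_(m, n) | forall i j, B i j (M i j)]].

Section matrix_measurability.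
Context (R : realType).

Lemma measurable_mx_coord m n (i : 'I_m) (j : 'I_n) :
  measurable_fun [set: 'M[R]_(m, n)] (fun M => M i j).
Proof.
move=> _ B mB; apply: sub_gen_smallest; exists (i, j) => //.
by exists B.
Qed.

Lemma measurable_mx_rectangles m n :
  measurable = <<s @mx_rectangles R m n >>.
Proof.
apply/seteqP; split.
  apply: smallest_sub; first exact: smallest_sigma_algebra.
  move=> _ [[i j] _ [B mB <-]]; apply: sub_gen_smallest.
  exists (fun i' j' => if (i' == i) && (j' == j) then B else setT); split.
    by move=> i' j'; case: ifP.
  apply/seteqP; split => [M /= [_ BM] i' j'|M /= BM].
    by case: ifP => // /andP[/eqP -> /eqP ->].
  by split => //; have := BM i j; rewrite !eqxx.
apply: smallest_sub; first exact: sigma_algebra_measurable.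
move=> _ [B [mB ->]].
rewrite (_ : [set _ | _] = \bigcap_(ij in [set: 'I_m * 'I_n])
   ((fun M : 'M[R]_(m, n) => M ij.1 ij.2) @^-1` B ij.1 ij.2)).
  apply: fin_bigcap_measurable => // ij _; rewrite -[X in measurable X]setTI.
  exact: measurable_mx_coord.
apply/seteqP; split => [M BM [i j] _ /=|M BM i j]; first exact: BM.
exact: (BM (i, j)).
Qed.

Lemma mx_rectanglesI m n : setI_closed (@mx_rectangles R m n).
Proof.
move=> _ _ [B [mB ->]] [C [mC ->]].
exists (fun i j => B i j `&` C i j); split.
  by move=> i j; exact: measurableI.
apply/seteqP; split => [M [BM CM] i j|M BCM]; first by split.
by split => i j; have [] := BCM i j.
Qed.

Lemma mx_rectanglesT m n : mx_rectangles [set: 'M[R]_(m, n)].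
Proof. by exists (fun _ _ => setT); split => //; apply/seteqP; split. Qed.

Lemma measurable_mx_rect m n (B : 'I_m -> 'I_n -> set R) :
  (forall i j, measurable (B i j)) ->
  measurable [set M : 'M[R]_(m, n) | forall i j, B i j (M i j)].
Proof.
move=> mB; rewrite measurable_mx_rectangles; apply: sub_gen_smallest.
by exists B.
Qed.

Lemma measurable_fun_mx d (T : measurableType d) m n (V : T -> 'M[R]_(m, n)) :
  (forall i j, measurable_fun setT (fun w => V w i j)) -> measurable_fun setT V.
Proof.
move=> mV; apply: (@measurability _ _ _ _ _ _ (@mx_coordinate_sets _ R m n)).
  by [].
move=> _ [_ [[i j] _ [B mB <-]] <-].
by rewrite !setTI /= -[X in measurable X]setTI; exact: mV.
Qed.

Lemma measurable_fun_coord d (T : measurableType d) m n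
    (V : T -> 'M[R]_(m, n)) (i : 'I_m) (j : 'I_n) :
  measurable_fun setT V -> measurable_fun setT (fun w => V w i j).
Proof.
move=> mV; apply: (@measurableT_comp _ _ _ _ _ _ (fun M : 'M[R]_(m, n) => M i j)) => //.
exact: measurable_mx_coord.
Qed.

Lemma measurable_preimage d (T : measurableType d) d' (U : measurableType d')
    (V : T -> U) C :
  measurable_fun setT V -> measurable C -> measurable (V @^-1` C).
Proof. by move=> mV mC; rewrite -[X in measurable X]setTI; exact: mV. Qed.

Lemma measurable_rect_preimage d (T : measurableType d) m n
    (V : T -> 'M[R]_(m, n)) (B : 'I_m -> 'I_n -> set R) :
  measurable_fun setT V -> (forall i j, measurable (B i j)) ->
  measurable [set w | forall i j, B i j (V w i j)].
Proof. by move=> mV mB; exact: measurable_preimage mV (measurable_mx_rect mB). Qed.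

Lemma measurable_mulmx d (T : measurableType d) m n q (A : 'M[R]_(m, n))
    (V : T -> 'M[R]_(n, q)) :
  measurable_fun setT V -> measurable_fun setT (fun w => A *m V w).
Proof.
move=> mV; apply: measurable_fun_mx => i j.
under eq_fun do rewrite mxE.
apply: measurable_sum => k; apply: measurable_funM => //.
exact: measurable_fun_coord.
Qed.

Lemma measurable_addmx d (T : measurableType d) m n (A : 'M[R]_(m, n))
    (V : T -> 'M[R]_(m, n)) :
  measurable_fun setT V -> measurable_fun setT (fun w => A + V w).
Proof.
move=> mV; apply: measurable_fun_mx => i j.
under eq_fun do rewrite mxE.
by apply: measurable_funD => //; exact: measurable_fun_coord.
Qed.

Lemma measurable_trmx d (T : measurableType d) m n (V : T -> 'M[R]_(m, n)) :
  measurable_fun setT V -> measurable_fun setT (fun w => (V w)^T).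
Proof.
move=> mV; apply: measurable_fun_mx => i j.
under eq_fun do rewrite mxE.
exact: measurable_fun_coord.
Qed.

Lemma measurable_row d (T : measurableType d) m n (V : T -> 'M[R]_(m, n)) i :
  measurable_fun setT V -> measurable_fun setT (fun w => row i (V w)).
Proof.
move=> mV; apply: measurable_fun_mx => i' j.
under eq_fun do rewrite mxE.
exact: measurable_fun_coord.
Qed.

End matrix_measurability.

(** * Rotation invariance of the standard normal law of the plane *)

Section standard_normal_plane.
Context {R : realType}.
Local Notation lam := (@lebesgue_measure R).
Local Notation lam2 := (lam \x lam)%E.
Local Notation R2 := (measurableTypeR R * measurableTypeR R)%type.

Lemma lebesgue_measure_translation (c : R) (A : set R) : measurable A ->
  lam ((fun y => y + c) @^-1` A) = lam A.
Proof.
move=> mA.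
have mc : measurable_fun setT (fun y : measurableTypeR R => (y + c : measurableTypeR R)).
  exact: measurable_funD.
have mc' := isMeasurableFun.Build _ _ _ _ _ mc.
pose f : {mfun measurableTypeR R >-> measurableTypeR R} :=
  HB.pack (fun y : measurableTypeR R => (y + c : measurableTypeR R)) mc'.
rewrite -[LHS]/(pushforward lam f A); apply/esym/lebesgue_measure_unique => //.
move=> _ [[a b]] _ <-; rewrite /= -[RHS]/(lam (f @^-1` `]a, b]%classic)).
rewrite (_ : f @^-1` _ = `]a - c, b - c]%classic).
  rewrite !lebesgue_measure_itv/= !lte_fin ltrD2r -!EFinB.
  by have -> : b - c - (a - c) = b - a by ring.
by apply/seteqP; split => x; rewrite /= !in_itv/= ltrBlDr lerBrDr.
Qed.

Definition preserves_area (g : R2 -> R2) :=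
  measurable_fun setT g /\
  forall C, measurable C -> lam2 (g @^-1` C) = lam2 C.

Lemma preserves_area_comp g h :
  preserves_area g -> preserves_area h -> preserves_area (h \o g).
Proof.
move=> [mg lg] [mh lh]; split; first exact: measurableT_comp.
by move=> C mC; rewrite comp_preimage lg ?lh//; exact: measurable_preimage.
Qed.

Lemma preserves_area_rectangles g : measurable_fun setT g ->
  (forall A B, measurable A -> measurable B ->
     lam2 (g @^-1` (A `*` B)) = lam A * lam B)%E -> preserves_area g.
Proof.
move=> mg gAB; split => // C mC.
by apply/esym; apply: (@product_measure_unique _ _ _ _ _ lam lam (pushforward lam2 g)).
Qed.

Lemma preserves_area_swap : preserves_area (fun z : R2 => (z.2, z.1)).
Proof.
apply: preserves_area_rectangles; first exact: measurable_fun_pair.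
move=> A B mA mB.
rewrite (_ : _ @^-1` _ = B `*` A).
  by rewrite product_measure1E// muleC.
by apply/seteqP; split => -[x y] /= [].
Qed.

(** Each vertical section of the preimage of a rectangle is a translate of a
    section of the rectangle. *)
Lemma preserves_area_shear (a : R) :
  preserves_area (fun z : R2 => (z.1, z.2 + a * z.1)).
Proof.
have ms : measurable_fun setT (fun z : R2 => ((z.1, z.2 + a * z.1) : R2)).
  apply: measurable_fun_pair => //; apply: measurable_funD => //.
  by apply: measurable_funM.
apply: preserves_area_rectangles => // A B mA mB.
rewrite /product_measure1 /=.
transitivity (\int[lam]_x (lam B * (\1_A x)%:E))%E.
  apply: eq_integral => x _ /=; rewrite indicE.
  have [xA|xA] := boolP (x \in A).
    rewrite mule1 -(lebesgue_measure_translation (a * x) mB); congr lebesgue_measure.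
    apply/seteqP; split => y; rewrite /xsection /= inE /=; first by case.
    by split => //; rewrite inE in xA.
  rewrite mule0 (_ : xsection _ _ = set0) ?measure0//.
  apply/seteqP; split => y //; rewrite /xsection /= inE /= => -[Ax _].
  by move: xA; rewrite notin_setE.
rewrite ge0_integralZl//=; last first.
  exact/measurable_EFinP/measurable_indic.
by rewrite integral_indic// setIT muleC.
Qed.

(** Rotation as a product of three shears; for angle t, the outer shears have
    slope (cos t - 1) / sin t = - tan (t / 2) and the middle one sin t. The
    swaps turn vertical shears into horizontal ones. *)
Lemma preserves_area_rotation (c s : R) : s != 0 -> c ^+ 2 + s ^+ 2 = 1 ->
  preserves_area (fun z : R2 => (c * z.1 - s * z.2, s * z.1 + c * z.2)).
Proof.
move=> s0 cs1.
pose sw (z : R2) : R2 := (z.2, z.1).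
pose sh (a : R) (z : R2) : R2 := (z.1, z.2 + a * z.1).
pose a := (c - 1) / s.
have as1 : a * s = c - 1 by rewrite /a divfK.
have a1c : a * (1 + c) = - s.
  apply: (mulfI s0); rewrite mulrA (mulrC s) as1 mulrN -expr2.
  have -> : s ^+ 2 = 1 - c ^+ 2 by rewrite -cs1; ring.
  by ring.
rewrite (_ : (fun z => _) = (sw \o sh a \o sw) \o (sh s \o (sw \o (sh a \o sw)))).
  do ![apply: preserves_area_comp]; by [exact: preserves_area_swap|exact: preserves_area_shear].
apply/funext => -[x y]; rewrite /sw /sh /=; congr pair.
  transitivity (x + (a * s) * x + (a * (1 + (1 + a * s))) * y); last by ring.
  by rewrite as1 addrC addrCA (addrCA 1) subrr addr0 a1c; ring.
transitivity (s * x + (1 + a * s) * y); last by ring.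
by rewrite as1 addrCA subrr addr0.
Qed.

Local Notation N01 := (@normal_prob R 0 1).
Local Notation phi := (@normal_pdf R 0 1).

Definition plane_density (z : R2) : \bar R := (phi z.1 * phi z.2)%:E.

Lemma measurable_plane_density : measurable_fun setT plane_density.
Proof.
apply/measurable_EFinP; apply: measurable_funM.
  by apply: measurableT_comp => //; exact: measurable_normal_pdf.
by apply: (@measurableT_comp _ _ _ _ _ _ phi) => //; exact: measurable_normal_pdf.
Qed.

Lemma plane_density_ge0 z : (0 <= plane_density z)%E.
Proof. by rewrite lee_fin mulr_ge0// normal_pdf_ge0. Qed.

Definition plane_prob (C : set R2) : \bar R :=
  (\int[lam2]_(z in C) plane_density z)%E.

Let plane_prob0 : plane_prob set0 = 0%E.
Proof. exact: integral_set0. Qed.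

Let plane_prob_ge0 C : (0 <= plane_prob C)%E.
Proof. by apply: integral_ge0 => z _; exact: plane_density_ge0. Qed.

Let plane_prob_sigma_additive : semi_sigma_additive plane_prob.
Proof.
move=> F mF tF mUF; rewrite /plane_prob ge0_integral_bigcup//; last 2 first.
- exact: measurable_funTS measurable_plane_density.
- by move=> z _; exact: plane_density_ge0.
by apply: is_cvg_ereal_nneg_natsum_cond => n _ _; exact: plane_prob_ge0.
Qed.

HB.instance Definition _ := isMeasure.Build _ _ _
  plane_prob plane_prob0 plane_prob_ge0 plane_prob_sigma_additive.

(** [plane_prob] is made a measure only to be compared with the product measure
    on rectangles. The point is to write the product of two normal laws as an
    integral against the rotation-invariant area. *)
Lemma plane_probE (C : set R2) : measurable C -> (N01 \x N01)%E C = plane_prob C.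
Proof.
move=> mC; apply: product_measure_unique => // A B mA mB.
rewrite /= /plane_prob integral_mkcond fubini_tonelli1; last 2 first.
- apply/(measurable_restrictT _ _).1 => //; first exact: measurableX.
  exact: measurable_funTS measurable_plane_density.
- by move=> z; rewrite patchE; case: ifP => // _; exact: plane_density_ge0.
have mphi D : measurable D -> measurable_fun D (EFin \o phi).
  by move=> mD; apply/measurable_EFinP; apply: measurable_funTS; exact: measurable_normal_pdf.
have phi0 x : (0 <= (phi x)%:E)%E by rewrite lee_fin normal_pdf_ge0.
transitivity (\int[lam]_x (((fun x => (phi x)%:E) \_ A) x * N01 B))%E.
  apply: eq_integral => x _; rewrite /fubini_F /= [in RHS]patchE.
  have [xA|xA] := boolP (x \in A); last first.
    rewrite mul0e integral0_eq// => y _; rewrite patchE.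
    by rewrite in_setX (negbTE xA).
  rewrite /normal_prob -ge0_integralZl//=; last exact: mphi.
  rewrite [RHS]integral_mkcond; apply: eq_integral => y _.
  by rewrite !patchE in_setX xA /= /plane_density /= EFinM.
rewrite ge0_integralZr//=.
- by congr (_ * _)%E; rewrite /normal_prob [RHS]integral_mkcond.
- by apply/(measurable_restrictT _ _).1 => //; exact: mphi.
- by move=> x _; rewrite patchE; case: ifP.
Qed.

Lemma plane_prob_preserved g : preserves_area g ->
  (forall z, plane_density (g z) = plane_density z) ->
  forall C, measurable C -> (N01 \x N01)%E (g @^-1` C) = (N01 \x N01)%E C.
Proof.
move=> [mg lg] gE C mC.
rewrite !plane_probE//; last exact: measurable_preimage.
rewrite /plane_prob.
transitivity (\int[lam2]_(z in g @^-1` C) (plane_density \o g) z)%E.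
  by apply: eq_integral => z _; rewrite /= gE.
have gint := @ge0_integral_pushforward _ _ R2 R2 R g mg lam2 C plane_density mC
  (measurable_funTS measurable_plane_density) (in1W plane_density_ge0).
apply: (eq_trans (esym gint)).
by apply: eq_measure_integral => D mD _; exact: lg.
Qed.

Lemma normal_prob_rotation (c s : R) : s != 0 -> c ^+ 2 + s ^+ 2 = 1 ->
  forall C : set R2, measurable C ->
  (N01 \x N01)%E ((fun z : R2 => (c * z.1 - s * z.2, s * z.1 + c * z.2)) @^-1` C)
  = (N01 \x N01)%E C.
Proof.
move=> s0 cs1; apply: plane_prob_preserved; first exact: preserves_area_rotation.
move=> -[x y]; rewrite /plane_density /=; congr EFin.
rewrite !normal_pdfE ?oner_neq0//.
rewrite mulrACA [RHS]mulrACA; congr (_ * _); rewrite /normal_fun -!expRD; congr expR.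
rewrite -!mulrDl; congr (_ / _); rewrite !subr0 -!opprD; congr (- _).
transitivity ((c ^+ 2 + s ^+ 2) * (x ^+ 2 + y ^+ 2)); first by ring.
by rewrite cs1 mul1r.
Qed.

Lemma normal_prob_opp (A : set R) : measurable A ->
  N01 (-%R @^-1` A) = N01 A.
Proof.
move=> mA; rewrite /normal_prob.
transitivity (\int[lam]_(x in -%R @^-1` A) ((fun x => (phi x)%:E) \o -%R) x)%E.
  apply: eq_integral => x _ /=; congr EFin.
  by rewrite !normal_pdfE ?oner_neq0// /normal_fun !subr0 sqrrN.
have mN : measurable_fun setT (-%R : measurableTypeR R -> measurableTypeR R).
  exact: measurable_funN.
have mphi : measurable_fun A (EFin \o phi).
  by apply/measurable_EFinP; apply: measurable_funTS; exact: measurable_normal_pdf.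
have phi0 : {in A, forall y, (0 <= (EFin \o phi) y)%E}.
  by move=> y _; rewrite lee_fin normal_pdf_ge0.
have gint := @ge0_integral_pushforward _ _ (measurableTypeR R) (measurableTypeR R)
  R _ mN lam A _ mA mphi phi0.
apply: (eq_trans (esym gint)).
by apply: eq_measure_integral => D mD _; exact: lebesgue_measureN.
Qed.

End standard_normal_plane.

(** * Standard normal matrices *)

(** The entries are i.i.d. standard normal. Only the values on rectangles are
    prescribed; they determine the law, see [standard_normal_law]. *)
Definition standard_normal_mx d (T : measurableType d) (R : realType)
    (P : probability T R) m n (V : T -> 'M[R]_(m, n)) : Prop :=
  measurable_fun setT V /\
  forall B : 'I_m -> 'I_n -> set R, (forall i j, measurable (B i j)) ->
    P [set w | forall i j, B i j (V w i j)]
    = (\prod_i \prod_j normal_prob 0 1 (B i j))%E.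

Lemma law_of_rectangles d1 (T1 : measurableType d1) d2 (T2 : measurableType d2)
    (R : realType) (P1 : probability T1 R) (P2 : probability T2 R) m n
    (V1 : T1 -> 'M[R]_(m, n)) (V2 : T2 -> 'M[R]_(m, n)) :
  measurable_fun setT V1 -> measurable_fun setT V2 ->
  (forall B : 'I_m -> 'I_n -> set R, (forall i j, measurable (B i j)) ->
    P1 [set w | forall i j, B i j (V1 w i j)]
    = P2 [set w | forall i j, B i j (V2 w i j)]) ->
  forall C, measurable C -> P1 (V1 @^-1` C) = P2 (V2 @^-1` C).
Proof.
move=> mV1 mV2 eqB C mC.
have mV2' := isMeasurableFun.Build _ _ _ _ _ mV2.
pose V2' : {mfun T2 >-> 'M[R]_(m, n)} := HB.pack V2 mV2'.
have := @indep_generator _ _ _ P1 _ _ (distribution P2 V2') _ V1 setT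
  (measurable_mx_rectangles R m n) (@mx_rectanglesI R m n)
  (mx_rectanglesT R m n) mV1 measurableT.
rewrite probability_setT => /(_ _ C mC); rewrite setTI mul1e; apply.
by move=> _ [B [mB ->]]; rewrite setTI mul1e eqB.
Qed.

Lemma standard_normal_law d1 (T1 : measurableType d1) d2 (T2 : measurableType d2)
    (R : realType) (P1 : probability T1 R) (P2 : probability T2 R) m n
    (V1 : T1 -> 'M[R]_(m, n)) (V2 : T2 -> 'M[R]_(m, n)) :
  standard_normal_mx P1 V1 -> standard_normal_mx P2 V2 ->
  forall C, measurable C -> P1 (V1 @^-1` C) = P2 (V2 @^-1` C).
Proof.
move=> [mV1 V1N] [mV2 V2N]; apply: law_of_rectangles => // B mB.
by rewrite V1N// V2N.
Qed.

Section standard_normal_maps.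
Context d (T : measurableType d) (R : realType) (P : probability T R).
Local Notation N01 := (@normal_prob R 0 1).

Lemma standard_normal_cvP m (V : T -> 'cV[R]_m) :
  standard_normal_mx P V <->
  measurable_fun setT V /\
  forall B : 'I_m -> set R, (forall i, measurable (B i)) ->
    P [set w | forall i, B i (V w i 0)] = (\prod_i N01 (B i))%E.
Proof.
split=> -[mV VN]; split => // B mB.
  have := VN (fun i _ => B i) (fun i _ => mB i).
  rewrite (eq_bigr (fun i => N01 (B i))) => [<-|i _]; last by rewrite big_ord1.
  congr (P _); apply/seteqP; split => w /= Bw i; last exact: Bw.
  by move=> j; rewrite (ord1 j).
rewrite (eq_bigr (fun i => N01 (B i 0))) => [|i _]; last by rewrite big_ord1.
rewrite -(VN _ (fun i => mB i 0)); congr (P _); apply/seteqP; split => w /= Bw i; first exact: Bw.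
by move=> j; rewrite (ord1 j).
Qed.

Lemma standard_normal_family_mx m (W : 'I_m -> {RV P >-> R}) :
  standard_normal_family W -> standard_normal_mx P (fun w => \col_i W i w).
Proof.
move=> [Wind WN]; apply/standard_normal_cvP; split.
  apply: measurable_fun_mx => i j; under eq_fun do rewrite mxE.
  exact: measurable_funPT.
move=> B mB; rewrite -[RHS](_ : (\prod_i P (W i @^-1` B i))%E = _).
  rewrite -Wind//; congr (P _); apply/seteqP; split => w /= Bw i.
    by have := Bw i; rewrite mxE.
  by rewrite mxE; exact: Bw.
by apply: eq_bigr => i _; exact: WN.
Qed.

Lemma standard_normal_trmx m n (V : T -> 'M[R]_(m, n)) :
  standard_normal_mx P V -> standard_normal_mx P (fun w => (V w)^T).
Proof.
move=> [mV VN]; split; first exact: measurable_trmx.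
move=> B mB; rewrite exchange_big/= -(VN (fun i j => B j i))//.
congr (P _); apply/seteqP; split => w /= Bw i j; last by rewrite mxE.
by have := Bw j i; rewrite mxE.
Qed.

Lemma standard_normal_row m n (V : T -> 'M[R]_(m, n)) i :
  standard_normal_mx P V -> standard_normal_mx P (fun w => row i (V w)).
Proof.
move=> [mV VN]; split; first exact: measurable_row.
move=> B mB; rewrite big_ord1.
have := VN (fun i' j => if i' == i then B 0 j else setT).
rewrite (bigD1 i)//= [X in (_ * X)%E]big1 ?mule1; last first.
  by move=> i' /negbTE ->; rewrite big1// => j _; rewrite probability_setT.
rewrite eqxx => <-; last by move=> i' j; case: ifP.
congr (P _); apply/seteqP; split => w /= Bw i' j.
  by case: eqP => // ->; have := Bw 0 j; rewrite mxE.
by rewrite (ord1 i') mxE; have := Bw i j; rewrite eqxx.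
Qed.

(** Independence of the entries is extended to blocks, here the rows, for
    arbitrary measurable events on each block. *)
Lemma standard_normal_rows_indep m n (V : T -> 'M[R]_(m, n)) :
  standard_normal_mx P V -> mutually_independent P (fun i w => row i (V w)).
Proof.
move=> VN; have [mV VB] := VN.
apply: (mutually_independent_generator (measurable_mx_rectangles R 1 n)
  (@mx_rectanglesI R 1 n) (mx_rectanglesT R 1 n)).
  by move=> i; exact: measurable_row.
move=> C HC.
pose B i := projT1 (cid (HC i)).
have BP i : (forall a b, measurable (B i a b)) /\
    C i = [set M | forall a b, B i a b (M a b)].
  exact: (projT2 (cid (HC i))).
have PC i : P ((fun w => row i (V w)) @^-1` C i) = (\prod_j N01 (B i 0%R j))%E.
  rewrite (BP i).2.
  have [_ /(_ _ (BP i).1)] := standard_normal_row i VN.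
  by rewrite big_ord1 => <-.
under [in RHS]eq_bigr do rewrite PC.
rewrite -(VB (fun i => B i 0)); last by move=> i j; exact: (BP i).1.
congr (P _); apply/seteqP; split => w /= Cw i.
  by move=> j; have := Cw i Logic.I; rewrite (BP i).2 /= => /(_ 0 j); rewrite mxE.
by move=> _; rewrite (BP i).2 => a b /=; rewrite (ord1 a) mxE; exact: Cw.
Qed.

End standard_normal_maps.

Lemma standard_normal_col_mx d1 (T1 : measurableType d1) d2
    (T2 : measurableType d2) (R : realType) (P1 : probability T1 R)
    (P2 : probability T2 R) m1 m2 n
    (V1 : T1 -> 'M[R]_(m1, n)) (V2 : T2 -> 'M[R]_(m2, n)) :
  standard_normal_mx P1 V1 -> standard_normal_mx P2 V2 ->
  standard_normal_mx (P1 \x P2)%E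
    (fun w => col_mx (V1 w.1) (V2 w.2) : 'M[R]_(m1 + m2, n)).
Proof.
move=> [mV1 V1N] [mV2 V2N]; split.
  apply: measurable_fun_mx => i j.
  under eq_fun do rewrite mxE.
  case: (fintype.split i) => k.
    apply: (@measurable_fun_coord _ _ _ _ _ (fun w : T1 * T2 => V1 w.1)).
    exact: measurableT_comp.
  apply: (@measurable_fun_coord _ _ _ _ _ (fun w : T1 * T2 => V2 w.2)).
  exact: measurableT_comp.
move=> B mB; rewrite big_split_ord /= -V1N// -V2N//.
rewrite -product_measure1E; last 2 first.
- by apply: (measurable_rect_preimage (B := fun i => B (lshift m2 i))).
- by apply: (measurable_rect_preimage (B := fun i => B (rshift m1 i))).
congr (_ _); apply/seteqP; split => w /=.
  by move=> Bw; split => i j;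
    [have := Bw (lshift _ i) j; rewrite col_mxEu
    |have := Bw (rshift _ i) j; rewrite col_mxEd].
move=> [Bw1 Bw2] i j; rewrite -[i]splitK mxE unsplitK.
by case: (fintype.split i) => k; [exact: Bw1|exact: Bw2].
Qed.

(** The rows of a matrix with i.i.d. normal rows may each be represented on a
    probability space of their own; this provides a common one. *)
Lemma standard_normal_exists (R : realType) m n :
  exists d (T : measurableType d) (P : probability T R) (V : T -> 'M[R]_(m, n)),
    standard_normal_mx P V.
Proof.
(* rows are stacked, a single row being the transpose of stacked scalars *)
have stack k q : (exists d (T : measurableType d) (P : probability T R)
      (V : T -> 'rV[R]_q), standard_normal_mx P V) ->
    exists d (T : measurableType d) (P : probability T R)
      (V : T -> 'M[R]_(k, q)), standard_normal_mx P V.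
  move=> [d1 [T1 [P1 [V1 V1N]]]].
  elim: k => [|k [d [T [P [V VN]]]]]; last first.
    by do 4 eexists; exact: standard_normal_col_mx V1N VN.
  exists d1, T1, P1, (fun=> 0); split; first exact: measurable_cst.
  move=> B mB; rewrite big_ord0 (_ : [set _ | _] = setT) ?probability_setT//.
  by apply/seteqP; split => // w _ [].
apply: (stack); have [|d [T [P [V VN]]]] := stack n 1%N; last first.
  by exists d, T, P, (fun w => (V w)^T); exact: standard_normal_trmx.
exists _, (measurableTypeR R), (@normal_prob R 0 1), (fun x => const_mx x).
apply/standard_normal_cvP; split.
  apply: measurable_fun_mx => i j; under eq_fun do rewrite mxE; exact: measurable_id.
move=> B mB; rewrite big_ord1; congr (normal_prob 0 1).
apply/seteqP; split => x /= Bx; first by have := Bx 0; rewrite mxE.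
by move=> i; rewrite (ord1 i) mxE.
Qed.

(** * Orthogonal maps that preserve the standard normal law *)

Section orthogonal_invariance.
Context d (T : measurableType d) (R : realType) (P : probability T R).
Local Notation N01 := (@normal_prob R 0 1).
Local Notation R2 := (measurableTypeR R * measurableTypeR R)%type.

(** The pair of rotated coordinates is independent of the other coordinates and
    has the normal law of the plane, which the rotation preserves. *)
Lemma standard_normal_rotate m (V V' : T -> 'cV[R]_m) (i k : 'I_m) (c s : R) :
  i != k -> s != 0 -> c ^+ 2 + s ^+ 2 = 1 ->
  (forall w, V' w i 0 = c * V w i 0 - s * V w k 0) ->
  (forall w, V' w k 0 = s * V w i 0 + c * V w k 0) ->
  (forall w l, l != i -> l != k -> V' w l 0 = V w l 0) ->
  standard_normal_mx P V -> standard_normal_mx P V'.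
Proof.
move=> ik s0 cs1 V'i V'k V'l /standard_normal_cvP[mV VN].
have mVl l : measurable_fun setT (fun w => V w l 0) by exact: measurable_fun_coord.
apply/standard_normal_cvP; split.
  apply: measurable_fun_mx => l j; rewrite (ord1 j).
  have [->|li] := eqVneq l i.
    under eq_fun do rewrite V'i.
    by apply: measurable_funB; apply: measurable_funM.
  have [->|lk] := eqVneq l k.
    under eq_fun do rewrite V'k.
    by apply: measurable_funD; apply: measurable_funM.
  by under eq_fun do rewrite V'l//; exact: mVl.
move=> B mB.
(* the event that concerns the coordinates left fixed *)
pose F := [set w | forall l, l != i -> l != k -> B l (V w l 0)].
pose pair w : R2 := (V w i 0, V w k 0).
have mpair : measurable_fun setT pair by apply: measurable_fun_pair; exact: mVl.
have mF : measurable F.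
  pose B' l := if (l == i) || (l == k) then setT else B l.
  have mB' l : measurable (B' l) by rewrite /B'; case: ifP.
  have := measurable_rect_preimage mV (fun i (_ : 'I_1) => mB' i).
  rewrite (_ : [set _ | _] = F)//; apply/seteqP; split => w /= Fw l.
    by move=> li lk; have := Fw l 0; rewrite /B' (negbTE li) (negbTE lk).
  by move=> j; rewrite (ord1 j) /B'; case: ifPn => //; rewrite negb_or => /andP[]; exact: Fw.
pose rest := (\prod_(l | (l != i) && (l != k)) N01 (B l))%E.
have rect (A1 A2 : set R) : measurable A1 -> measurable A2 ->
    P (F `&` pair @^-1` (A1 `*` A2)) = (rest * (N01 A1 * N01 A2))%E.
  move=> mA1 mA2.
  pose B' l : set R := if l == i then A1 else if l == k then A2 else B l.
  have mB' l : measurable (B' l) by rewrite /B'; do 2 case: ifP => // _.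
  transitivity (P [set w | forall l, B' l (V w l 0)]).
    congr (P _); apply/seteqP; split => w /=.
      move=> [Fw [Vi Vk]] l; rewrite /B'; case: ifPn => [/eqP->//|li].
      by case: ifPn => [/eqP->//|lk]; exact: Fw.
    move=> Bw; split.
      by move=> l /negbTE li /negbTE lk; have := Bw l; rewrite /B' li lk.
    split => /=; first by have := Bw i; rewrite /B' eqxx.
    by have := Bw k; rewrite /B' eq_sym (negbTE ik) eqxx.
  rewrite VN// (bigD1 i)//= (bigD1 k)//= 1?eq_sym//.
  rewrite /B' eqxx eq_sym (negbTE ik) eqxx.
  rewrite [RHS]muleC muleA; congr (_ * _)%E.
  by apply: eq_bigr => l /andP[/negbTE -> /negbTE ->].
have PF : P F = rest.
  have := rect _ _ measurableT measurableT.
  by rewrite setXTT preimage_setT setIT !probability_setT !mule1.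
pose rects := [set A `*` B | A in @measurable _ (measurableTypeR R)
                           & B in @measurable _ (measurableTypeR R)].
have ind C : measurable C ->
    P (F `&` pair @^-1` C) = (P F * (N01 \x N01) C)%E.
  apply: (@indep_generator _ _ _ P _ R2 (N01 \x N01)%E rects pair F
    (measurable_prod_measurableType _ _) _ _ mpair mF).
  - move=> _ _ [A1 mA1 [A2 mA2 <-]] [A3 mA3 [A4 mA4 <-]].
    exists (A1 `&` A3); first exact: measurableI.
    by exists (A2 `&` A4); [exact: measurableI|rewrite setXI].
  - by exists setT => //; exists setT => //; rewrite setXTT.
  - move=> _ [A1 mA1 [A2 mA2 <-]].
    by rewrite rect// PF; congr (_ * _)%E; apply/esym; exact: product_measure1E.
pose rot (z : R2) : R2 := (c * z.1 - s * z.2, s * z.1 + c * z.2).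
have mrot : measurable_fun setT rot.
  by apply: measurable_fun_pair; [apply: measurable_funB|apply: measurable_funD];
    apply: measurable_funM.
have mBB : measurable (B i `*` B k : set R2) by apply: measurableX; exact: mB.
transitivity (P (F `&` pair @^-1` (rot @^-1` (B i `*` B k)))).
  congr (P _); apply/seteqP; split => w /=.
    move=> Bw; split; first by move=> l li lk; rewrite -V'l.
    by split; rewrite /rot /pair /= -?V'i -?V'k.
  move=> [Fw [/= ]]; rewrite -V'i -V'k => Bi Bk l.
  have [->//|li] := eqVneq l i; have [->//|lk] := eqVneq l k.
  by rewrite V'l//; exact: Fw.
rewrite ind; last exact: measurable_preimage.
rewrite normal_prob_rotation// PF.
have -> : (N01 \x N01)%E (B i `*` B k) = (N01 (B i) * N01 (B k))%E.
  by apply: product_measure1E; exact: mB.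
rewrite [RHS](bigD1 i)//= (bigD1 k)//= 1?eq_sym//.
by rewrite muleC muleA.
Qed.

Lemma standard_normal_flip m (V V' : T -> 'cV[R]_m) (i : 'I_m) :
  (forall w, V' w i 0 = - V w i 0) ->
  (forall w l, l != i -> V' w l 0 = V w l 0) ->
  standard_normal_mx P V -> standard_normal_mx P V'.
Proof.
move=> V'i V'l /standard_normal_cvP[mV VN].
have mVl l : measurable_fun setT (fun w => V w l 0) by exact: measurable_fun_coord.
apply/standard_normal_cvP; split.
  apply: measurable_fun_mx => l j; rewrite (ord1 j).
  have [->|li] := eqVneq l i.
    by under eq_fun do rewrite V'i; exact: measurable_funN.
  by under eq_fun do rewrite V'l//; exact: mVl.
move=> B mB.
pose B' l := if l == i then -%R @^-1` B l else B l.
have mB' l : measurable (B' l).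
  by rewrite /B'; case: ifP => // _; apply: measurable_preimage => //; exact: measurable_funN.
transitivity (P [set w | forall l, B' l (V w l 0)]).
  congr (P _); apply/seteqP; split => w /= Bw l; have := Bw l; rewrite /B'.
    by case: eqP => [->|/eqP li]; rewrite ?V'i// V'l.
  by case: eqP => [->|/eqP li]; rewrite ?V'i// V'l.
rewrite VN//; apply: eq_bigr => l _; rewrite /B'.
by case: eqP => // _; exact: normal_prob_opp.
Qed.

End orthogonal_invariance.

Section orthogonal_matrices.
Context d (T : measurableType d) (R : realType) (P : probability T R).

(** Closure under transposition is built in, because conjugating by such a
    matrix uses its inverse too. *)
Definition gaussian_isometry m (O : 'M[R]_m) : Prop :=
  [/\ O^T *m O = 1%:M,
      forall V : T -> 'cV[R]_m,
        standard_normal_mx P V -> standard_normal_mx P (fun w => O *m V w)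
    & forall V : T -> 'cV[R]_m,
        standard_normal_mx P V -> standard_normal_mx P (fun w => O^T *m V w)].

Lemma gaussian_isometry1 m : gaussian_isometry (1%:M : 'M[R]_m).
Proof.
by split; rewrite ?trmx1 ?mulmx1// => V VN; under eq_fun do rewrite mul1mx.
Qed.

Lemma gaussian_isometryM m (O1 O2 : 'M[R]_m) :
  gaussian_isometry O1 -> gaussian_isometry O2 -> gaussian_isometry (O1 *m O2).
Proof.
move=> [i1 n1 t1] [i2 n2 t2]; split.
- by rewrite trmx_mul mulmxA -(mulmxA O2^T) i1 mulmx1.
- by move=> V VN; under eq_fun do rewrite -mulmxA; exact/n1/n2.
- by move=> V VN; under eq_fun do rewrite trmx_mul -mulmxA; exact/t2/t1.
Qed.

Lemma gaussian_isometryT m (O : 'M[R]_m) :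
  gaussian_isometry O -> gaussian_isometry O^T.
Proof.
by move=> [i n t]; split; rewrite ?trmxK//; exact: mulmx1C.
Qed.

Definition givens m (i k : 'I_m) (c s : R) : 'M[R]_m :=
  \matrix_(a, b) if a == i then c *+ (b == i) - s *+ (b == k)
                 else if a == k then s *+ (b == i) + c *+ (b == k)
                 else (a == b)%:R.

Lemma sum_mulr_delta m (f : 'I_m -> R) (x : R) i :
  \sum_j (x *+ (j == i)) * f j = x * f i.
Proof.
rewrite (bigD1 i)//= eqxx big1 ?addr0// => j /negbTE ->.
by rewrite mul0r.
Qed.

Lemma givensE m (i k : 'I_m) c s n (v : 'M[R]_(m, n)) a j :
  (givens i k c s *m v) a j =
  if a == i then c * v i j - s * v k j
  else if a == k then s * v i j + c * v k j else v a j.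
Proof.
rewrite mxE; under eq_bigr do rewrite mxE.
case: ifP => _.
  under eq_bigr do rewrite mulrBl.
  by rewrite sumrB !(sum_mulr_delta (v^~ j)).
case: ifP => _.
  under eq_bigr do rewrite mulrDl.
  by rewrite big_split /= !(sum_mulr_delta (v^~ j)).
under eq_bigr do rewrite eq_sym.
by rewrite (sum_mulr_delta (v^~ j)) mul1r.
Qed.

Lemma givens_tr m (i k : 'I_m) c s : i != k ->
  (givens i k c s)^T = givens i k c (- s).
Proof.
move=> /negbTE ik; have ki : (k == i) = false by rewrite eq_sym.
apply/matrixP => a b; rewrite !mxE.
have [ai|/negbTE ai] := eqVneq a i; [|have [ak|/negbTE ak] := eqVneq a k];
  (have [bi|/negbTE bi] := eqVneq b i; [|have [bk|/negbTE bk] := eqVneq b k]).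
all: try subst a; try subst b.
all: rewrite ?eqxx ?ik ?ki ?ai ?ak ?bi ?bk ?(eq_sym i) ?(eq_sym k)
    ?ai ?ak ?bi ?bk ?ik ?ki ?mulr1n ?mulr0n ?subr0 ?add0r ?addr0 ?sub0r ?opprK//.
by rewrite eq_sym.
Qed.

Lemma gaussian_isometry_givens m (i k : 'I_m) c s :
  i != k -> s != 0 -> c ^+ 2 + s ^+ 2 = 1 -> gaussian_isometry (givens i k c s).
Proof.
move=> ik s0 cs1.
have norm c' s' (V : T -> 'cV[R]_m) : s' != 0 -> c' ^+ 2 + s' ^+ 2 = 1 ->
    standard_normal_mx P V ->
    standard_normal_mx P (fun w => givens i k c' s' *m V w).
  move=> s'0 cs'1; apply: (standard_normal_rotate ik s'0 cs'1) => w.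
  - by rewrite givensE eqxx.
  - by rewrite givensE eq_sym (negbTE ik) eqxx.
  - by move=> l /negbTE li /negbTE lk; rewrite givensE li lk.
rewrite /gaussian_isometry givens_tr//; split; last 2 first.
- by move=> V; exact: norm.
- by move=> V; apply: norm; rewrite ?oppr_eq0 ?sqrrN.
have ki : (k == i) = false by rewrite eq_sym (negbTE ik).
apply/matrixP => a b; rewrite givensE -[in RHS](mul1mx 1%:M) !mul1mx.
have gE a' : givens i k c s a' b = (givens i k c s *m 1%:M) a' b by rewrite mulmx1.
have [->|/negbTE ai] := eqVneq a i; last have [->|/negbTE ak] := eqVneq a k.
- rewrite !gE !givensE !eqxx ki.
  transitivity ((c ^+ 2 + s ^+ 2) * (1%:M : 'M[R]_m) i b); first by ring.
  by rewrite cs1 mul1r.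
- rewrite !gE !givensE !eqxx ki.
  transitivity ((c ^+ 2 + s ^+ 2) * (1%:M : 'M[R]_m) k b); first by ring.
  by rewrite cs1 mul1r.
- by rewrite gE givensE ai ak.
Qed.

Definition reflection m (i : 'I_m) : 'M[R]_m :=
  \matrix_(a, b) (if a == i then - (a == b)%:R else (a == b)%:R).

Lemma reflectionE m (i : 'I_m) n (v : 'M[R]_(m, n)) a j :
  (reflection i *m v) a j = if a == i then - v a j else v a j.
Proof.
rewrite mxE; case: ifP => ai.
  under eq_bigr do rewrite mxE ai (eq_sym a) mulNr.
  by rewrite sumrN (sum_mulr_delta (v^~ j)) mul1r.
under eq_bigr do rewrite mxE ai (eq_sym a).
by rewrite (sum_mulr_delta (v^~ j)) mul1r.
Qed.

Lemma reflection_tr m (i : 'I_m) : (reflection i)^T = reflection i.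
Proof.
apply/matrixP => a b; rewrite !mxE (eq_sym b a).
by have [->//|_] := eqVneq a b; rewrite oppr0; do 2 case: ifP.
Qed.

Lemma gaussian_isometry_reflection m (i : 'I_m) : gaussian_isometry (reflection i).
Proof.
have norm (V : T -> 'cV[R]_m) : standard_normal_mx P V ->
    standard_normal_mx P (fun w => reflection i *m V w).
  apply: (standard_normal_flip (i := i)) => w; first by rewrite reflectionE eqxx.
  by move=> l /negbTE li; rewrite reflectionE li.
split; rewrite ?reflection_tr//.
apply/matrixP => a b; rewrite reflectionE -[reflection i]mulmx1 reflectionE.
by case: (a == i); rewrite ?opprK.
Qed.

(** Each coordinate in turn is rotated against the coordinate 0 until it
    vanishes. *)
Lemma gaussian_isometry_to_axis m (u : 'cV[R]_m.+1) :
  exists2 O, gaussian_isometry O & exists r, O *m u = r *: delta_mx 0 0.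
Proof.
suff zeroed h : exists2 O, gaussian_isometry O &
    forall l : 'I_m.+1, (0 < l <= h)%N -> (O *m u) l 0 = 0.
  have [ O gO Ou] := zeroed m.
  exists O => //; move: Ou; move: (O *m u) => v v0; exists (v 0 0).
  apply/colP => l; rewrite !mxE andbT.
  have [->|l0] := eqVneq l 0; first by rewrite mulr1.
  rewrite mulr0 v0// lt0n -ltnS ltn_ord andbT.
  by apply: contra l0 => /eqP l0; apply/eqP/val_inj.
elim: h => [|h [ O gO Ou]].
  exists 1%:M; first exact: gaussian_isometry1.
  by case=> -[|l].
have [hm|mh] := leqP h.+1 m; last first.
  exists O => // l /andP[l0 lh]; apply: Ou; rewrite l0 /=.
  exact: leq_trans (leq_ord l) mh.
pose k : 'I_m.+1 := Ordinal (hm : (h.+1 < m.+1)%N).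
have k0 : (0 : 'I_m.+1) != k by [].
set v := O *m u in Ou.
have [vk0|vk0] := eqVneq (v k 0) 0.
  exists O => // l /andP[l0]; rewrite leq_eqVlt => /orP[/eqP lh|lh].
    by rewrite -vk0; congr (v _ _); exact: val_inj.
  by apply: Ou; rewrite l0.
pose r := Num.sqrt (v 0 0 ^+ 2 + v k 0 ^+ 2).
have r2 : r ^+ 2 = v 0 0 ^+ 2 + v k 0 ^+ 2.
  by rewrite sqr_sqrtr// addr_ge0// sqr_ge0.
have r0 : r != 0.
  rewrite -sqrf_eq0 r2 gt_eqF// ltr_wpDl ?sqr_ge0//.
  by rewrite exprn_even_gt0.
(* the coefficients make the new coordinate k equal to - vk v0 / r + v0 vk / r *)
exists (givens 0 k (v 0 0 / r) (- (v k 0 / r)) *m O).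
  apply: gaussian_isometryM => //; apply: gaussian_isometry_givens => //.
    by rewrite oppr_eq0 mulf_neq0// invr_eq0.
  by rewrite sqrrN !exprMn -mulrDl -r2 exprVn divff// sqrf_eq0.
move=> l /andP[l0 lh]; rewrite -mulmxA givensE.
have /negbTE -> : l != 0 by apply: contraTneq l0 => ->.
have [lk|lk] := eqVneq l k; first by rewrite -/v; ring.
apply: Ou; rewrite l0 /= -ltnS ltn_neqAle lh andbT.
by apply: contra lk => /eqP lk; apply/eqP/val_inj.
Qed.

Definition dot_cv m (u v : 'cV[R]_m) : R := (u^T *m v) 0 0.

(** If O moves u to the first axis, the reflection in u is the change of sign
    of the coordinate 0 conjugated by O. *)
Lemma gaussian_isometry_householder m (u : 'cV[R]_m.+1) : u != 0 ->
  exists2 H, gaussian_isometry H &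
    forall v, H *m v = v - (2 * dot_cv u v / dot_cv u u) *: u.
Proof.
move=> u0; have [ O gO [r Ou]] := gaussian_isometry_to_axis u.
have [OTO _ _] := gO; have OOT := mulmx1C OTO.
have uE : u = r *: (O^T *m delta_mx 0 0).
  by rewrite scalemxAr -Ou mulmxA OTO mul1mx.
have r0 : r != 0 by apply: contraNneq u0 => r0; rewrite uE r0 scale0r.
have dotE v : dot_cv u v = r * (O *m v) 0 0.
  rewrite /dot_cv {1}uE linearZ /= trmx_mul trmxK -scalemxAl mxE -mulmxA.
  congr (_ * _); rewrite [LHS]mxE (bigD1 0)//= big1 ?addr0.
    by rewrite !mxE eqxx mul1r.
  by move=> i /negbTE i0; rewrite !mxE i0 mul0r.
have dotu : dot_cv u u = r ^+ 2 by rewrite dotE Ou !mxE !eqxx mulr1.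
exists (O^T *m (reflection 0 *m O)).
  apply: gaussian_isometryM; first exact: gaussian_isometryT.
  by apply: gaussian_isometryM => //; exact: gaussian_isometry_reflection.
move=> v; rewrite dotu dotE.
have -> : 2 * (r * (O *m v) 0 0) / r ^+ 2 = (2 * (O *m v) 0 0) / r.
  by field.
rewrite [X in _ *: X]uE scalerA divfK//.
rewrite -!mulmxA.
have -> : reflection 0 *m (O *m v) = O *m v - (2 * (O *m v) 0 0) *: delta_mx 0 0.
  apply/colP => i; rewrite reflectionE !mxE andbT.
  have [->|i0] := eqVneq i 0; last by rewrite mulr0 subr0.
  by rewrite mulr1; ring.
by rewrite mulmxBr mulmxA OTO mul1mx -scalemxAr.
Qed.

End orthogonal_matrices.

(** * The law of a linear image depends only on the Gram matrix *)

Section gram.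
Context d (T : measurableType d) (R : realType) (P : probability T R).

(** Rows are matched one after another. If rows 0 to h - 1 of A and B agree
    already, the reflection in the difference of the two rows h exchanges these
    rows, since they have the same norm. It fixes the earlier rows, since by
    equality of the Gram matrices they are orthogonal to that difference. *)
Lemma gram_isometry q m (A B : 'M[R]_(q, m)) : A *m A^T = B *m B^T ->
  exists2 O, gaussian_isometry P O & A *m O = B.
Proof.
case: m A B => [|m] A B AB.
  exists 1%:M; first exact: gaussian_isometry1.
  by rewrite mulmx1 (thinmx0 A) (thinmx0 B).
have ABE i j : dot_cv (row i A)^T (row j A)^T = dot_cv (row i B)^T (row j B)^T.
  have dotE (C : 'M[R]_(q, m.+1)) : dot_cv (row i C)^T (row j C)^T = (C *m C^T) i j.
    by rewrite /dot_cv trmxK !mxE; apply: eq_bigr => l _; rewrite !mxE.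
  by rewrite !dotE AB.
suff agree h : exists2 O, gaussian_isometry P O &
    forall i : 'I_q, (i < h)%N -> row i (A *m O) = row i B.
  have [ O gO AO] := agree q; exists O => //.
  by apply/row_matrixP => i; exact: AO.
elim: h => [|h [ O gO AO]]; first by exists 1%:M => //; exact: gaussian_isometry1.
have [hq|qh] := ltnP h q; last first.
  by exists O => // i _; apply: AO; exact: leq_trans (ltn_ord i) qh.
pose k := Ordinal hq.
have [ OTO _ _] := gO.
pose a i := (row i (A *m O))^T; pose b i := (row i B)^T.
have aE i : a i = O^T *m (row i A)^T by rewrite /a row_mul trmx_mul.
have abE i j : dot_cv (a i) (a j) = dot_cv (b i) (b j).
  rewrite -ABE !aE /dot_cv trmx_mul !trmxK -mulmxA (mulmxA O).
  by rewrite (mulmx1C OTO) mul1mx.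
have ab (i : 'I_q) : (i < h)%N -> a i = b i by move=> ih; rewrite /a AO.
have [akk|akk] := eqVneq (a k - b k) 0.
  exists O => // i; rewrite ltnS leq_eqVlt => /orP[/eqP ih|]; last exact: AO.
  have -> : i = k by exact: val_inj.
  by apply: trmx_inj; apply/eqP; rewrite -subr_eq0; apply/eqP.
have [H gH HE] := gaussian_isometry_householder P akk.
have dotBl (u v w : 'cV[R]_m.+1) : dot_cv (u - v) w = dot_cv u w - dot_cv v w.
  by rewrite /dot_cv linearB /= mulmxBl !mxE.
have dotBr (u v w : 'cV[R]_m.+1) : dot_cv w (u - v) = dot_cv w u - dot_cv w v.
  by rewrite /dot_cv mulmxBr !mxE.
have dotC (u v : 'cV[R]_m.+1) : dot_cv u v = dot_cv v u.
  by rewrite /dot_cv -[in RHS](trmxK u) -trmx_mul [RHS]mxE.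
have dotu0 : dot_cv (a k - b k) (a k - b k) != 0.
  apply: contra akk => /eqP; rewrite /dot_cv mxE => /eqP.
  rewrite psumr_eq0; last by move=> i _; rewrite mxE -expr2 sqr_ge0.
  move=> /allP u0; apply/eqP/colP => i; apply/eqP.
  have := u0 i (mem_index_enum _); rewrite /= mxE mulf_eq0 orbb.
  by rewrite [X in _ -> _ == X]mxE.
exists (O *m H^T); first by apply: gaussian_isometryM => //; exact: gaussian_isometryT.
move=> i ih.
apply: trmx_inj; rewrite mulmxA row_mul trmx_mul trmxK -/(a i) -/(b i) HE.
move: ih; rewrite ltnS leq_eqVlt => /orP[/eqP ih|ih]; last first.
  by rewrite dotBl {1}(ab i ih) dotC abE -(ab i ih) (dotC (b k)) subrr mulr0 mul0r scale0r subr0.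
have -> : i = k by exact: val_inj.
have -> : 2 * dot_cv (a k - b k) (a k) = dot_cv (a k - b k) (a k - b k).
  rewrite !dotBl !dotBr -(abE k k) (dotC (b k) (a k)); ring.
by rewrite divff// scale1r opprB addrC subrK.
Qed.

End gram.

(** For each Sigma, this makes N(0, Sigma) independent of the choice of the
    factor A with A A' = Sigma. *)
Lemma gaussian_law_of_gram d1 (T1 : measurableType d1) d2 (T2 : measurableType d2)
    (R : realType) (P1 : probability T1 R) (P2 : probability T2 R) q m
    (V1 : T1 -> 'cV[R]_m) (V2 : T2 -> 'cV[R]_m) (A B : 'M[R]_(q, m)) :
  standard_normal_mx P1 V1 -> standard_normal_mx P2 V2 ->
  A *m A^T = B *m B^T ->
  forall C : set 'cV[R]_q, measurable C ->
    P1 [set w | C (A *m V1 w)] = P2 [set w | C (B *m V2 w)].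
Proof.
move=> V1N V2N AB C mC.
have [ O [_ ON _] <-] := gram_isometry P2 AB.
have mAC : measurable [set v : 'cV[R]_m | C (A *m v)].
  exact: measurable_preimage (measurable_mulmx A (@measurable_id _ _ setT)) mC.
rewrite (_ : [set w | C (A *m O *m V2 w)] =
    (fun w => O *m V2 w) @^-1` [set v : 'cV[R]_m | C (A *m v)]).
  exact: (standard_normal_law V1N (ON _ V2N)).
by apply/seteqP; split => w /=; rewrite mulmxA.
Qed.

Lemma semiorthogonal_le (R : realType) q n (M : 'M[R]_(q, n)) :
  M *m M^T = 1%:M -> (q <= n)%N.
Proof.
move=> MMT; have := leq_trans (mxrankM_maxl M M^T) (rank_leq_col M).
by rewrite MMT mxrank1.
Qed.

Section semiorthogonal.
Context d (T : measurableType d) (R : realType) (P : probability T R).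

(** M has the same Gram matrix as the projection onto the first q coordinates,
    and the first q entries of V are i.i.d. standard normal. *)
Lemma standard_normal_semiorthogonal_cv q n (M : 'M[R]_(q, n)) (V : T -> 'cV[R]_n) :
  M *m M^T = 1%:M -> standard_normal_mx P V ->
  standard_normal_mx P (fun w => M *m V w).
Proof.
move=> MMT VN; have [mV _] := VN; split; first exact: measurable_mulmx.
move=> B mB.
have [r nE] : exists r, n = (q + r)%N.
  by exists (n - q)%N; rewrite subnKC// (semiorthogonal_le MMT).
move: M MMT V VN mV; rewrite nE => M MMT V VN mV.
have gramE : M *m M^T = row_mx 1%:M 0 *m (row_mx 1%:M (0 : 'M[R]_(q, r)))^T.
  by rewrite MMT tr_row_mx mul_row_col trmx1 mulmx1 mul0mx addr0.
have := gaussian_law_of_gram VN VN gramE (measurable_mx_rect mB).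
move=> /= ->.
have [_ VB] := VN.
pose B' (i : 'I_(q + r)) j : set R :=
  if fintype.split i is inl i' then B i' j else setT.
have rowE w : row_mx 1%:M (0 : 'M[R]_(q, r)) *m V w = usubmx (V w).
  by rewrite -[V w in LHS]vsubmxK mul_row_col mul1mx mul0mx addr0.
transitivity (P [set w | forall i j, B' i j (V w i j)]).
  congr (P _); apply/seteqP; split => w /= Bw i j; last first.
    have := Bw (lshift _ i) j; rewrite /B' (unsplitK (inl i)).
    by rewrite rowE mxE.
  rewrite /B'; case: splitP => // i' ii'; have := Bw i' j; rewrite rowE mxE.
  by rewrite (_ : lshift r i' = i)//; exact: val_inj.
rewrite VB; last by move=> i j; rewrite /B'; case: fintype.split.
rewrite big_split_ord /= [X in (_ * X)%E]big1 ?mule1.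
  by apply: eq_bigr => i _; rewrite /B' (unsplitK (inl i)).
move=> i _; rewrite /B' (unsplitK (inr i)) big1// => j _.
by rewrite probability_setT.
Qed.

(** The columns of V are independent, and M acts on each of them separately. *)
Lemma standard_normal_semiorthogonal q n p (M : 'M[R]_(q, n))
    (V : T -> 'M[R]_(n, p)) :
  M *m M^T = 1%:M -> standard_normal_mx P V ->
  standard_normal_mx P (fun w => M *m V w).
Proof.
move=> MMT VN; have [mV _] := VN; split; first exact: measurable_mulmx.
move=> B mB.
have VTN := standard_normal_trmx VN.
have colE w i j (k : 'I_1) : (M *m (row j (V w)^T)^T) i k = (M *m V w) i j.
  by rewrite !mxE; apply: eq_bigr => l _; rewrite !mxE.
have colN j : standard_normal_mx P (fun w => M *m (row j (V w)^T)^T).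
  apply: standard_normal_semiorthogonal_cv => //.
  exact: standard_normal_trmx (standard_normal_row j VTN).
pose C j := [set v : 'rV[R]_n | forall i (k : 'I_1), B i j ((M *m v^T) i k)].
have mC j : measurable (C j).
  apply: (measurable_rect_preimage (B := fun i _ => B i j)) => //.
  by apply: measurable_mulmx; apply: measurable_trmx; exact: measurable_id.
have := standard_normal_rows_indep VTN mC.
rewrite exchange_big /= => VC.
transitivity (\prod_j P ((fun w => row j (V w)^T) @^-1` C j))%E.
  rewrite -VC; congr (P _); apply/seteqP; split => w /= Bw.
    by move=> j _ i k /=; rewrite colE.
  by move=> i j; rewrite -(colE w i j 0); exact: Bw.
apply: eq_bigr => j _.
have [_ /(_ _ (fun i (_ : 'I_1) => mB i j))] := colN j.
under [in RHS]eq_bigr do rewrite big_ord1.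
by move=> <-.
Qed.

End semiorthogonal.

(** * Matrices with i.i.d. normal rows *)

Lemma independent_rows_law d1 (T1 : measurableType d1) d2 (T2 : measurableType d2)
    (R : realType) (P1 : probability T1 R) (P2 : probability T2 R) n p
    (V1 : T1 -> 'M[R]_(n, p)) (V2 : T2 -> 'M[R]_(n, p)) :
  measurable_fun setT V1 -> measurable_fun setT V2 ->
  mutually_independent P1 (fun i w => row i (V1 w)) ->
  mutually_independent P2 (fun i w => row i (V2 w)) ->
  (forall i (C : set 'rV[R]_p), measurable C ->
     P1 ((fun w => row i (V1 w)) @^-1` C) = P2 ((fun w => row i (V2 w)) @^-1` C)) ->
  forall C, measurable C -> P1 (V1 @^-1` C) = P2 (V2 @^-1` C).
Proof.
move=> mV1 mV2 ind1 ind2 rowE; apply: law_of_rectangles => // B mB.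
pose C i := [set v : 'rV[R]_p | forall (k : 'I_1) j, B i j (v k j)].
have mC i : measurable (C i).
  by apply: (measurable_mx_rect (B := fun _ => B i)).
have rectE (U : Type) (V : U -> 'M[R]_(n, p)) :
    [set w | forall i j, B i j (V w i j)]
    = \bigcap_(i in [set: 'I_n]) ((fun w => row i (V w)) @^-1` C i).
  apply/seteqP; split => w /= Bw.
    by move=> i _ k j /=; rewrite mxE.
  by move=> i j; have := Bw i Logic.I 0 j; rewrite mxE.
by rewrite !rectE ind1// ind2//; apply: eq_bigr => i _; exact: rowE.
Qed.

Lemma multivariate_normal_law d1 (T1 : measurableType d1) d2
    (T2 : measurableType d2) (R : realType) (P : probability T1 R)
    (Q : probability T2 R) p (V : T1 -> 'cV[R]_p) (m : 'cV[R]_p)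
    (Sigma A : 'M[R]_p) (W : T2 -> 'cV[R]_p) :
  multivariate_normal P V m Sigma -> standard_normal_mx Q W ->
  A *m A^T = Sigma ->
  forall C, measurable C -> P (V @^-1` C) = Q [set w | C (m + A *m W w)].
Proof.
move=> [d' [T' [Q' [W' [A' [W'N A'A' VE]]]]]] WN AA C mC.
rewrite VE//.
have mmC : measurable [set v : 'cV[R]_p | C (m + v)].
  apply: (measurable_preimage _ mC).
  exact: measurable_addmx (@measurable_id _ _ setT).
apply: (gaussian_law_of_gram (standard_normal_family_mx W'N) WN _ mmC).
by rewrite A'A' AA.
Qed.

(** A single factor A serves all rows, although the representations given by
    [iid_normal_rows] may use a different factor for each row. *)
Lemma iid_normal_rows_law d1 (T1 : measurableType d1) d2 (T2 : measurableType d2)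
    (R : realType) (P : probability T1 R) (Q : probability T2 R) n p
    (E : T1 -> 'M[R]_(n, p)) (Sigma A : 'M[R]_p) (V : T2 -> 'M[R]_(n, p)) :
  measurable_fun setT E -> iid_normal_rows P E Sigma ->
  standard_normal_mx Q V -> A *m A^T = Sigma ->
  forall C, measurable C -> P (E @^-1` C) = Q [set w | C (V w *m A^T)].
Proof.
move=> mE [Eind EN] VN AA C mC; have [mV _] := VN.
have mulE w : V w *m A^T = (A *m (V w)^T)^T by rewrite trmx_mul trmxK.
have mVA : measurable_fun setT (fun w => V w *m A^T).
  under eq_fun do rewrite mulE.
  by apply/measurable_trmx/measurable_mulmx/measurable_trmx.
have mrowA (D : set 'rV[R]_p) : measurable D ->
    measurable [set v : 'rV[R]_p | D (v *m A^T)].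
  move=> mD; rewrite (_ : [set _ | _] = (fun v : 'rV_p => (A *m v^T)^T) @^-1` D).
    apply: measurable_preimage mD.
    apply/measurable_trmx/measurable_mulmx/measurable_trmx; exact: measurable_id.
  by apply/seteqP; split => v /=; rewrite trmx_mul trmxK.
apply: (independent_rows_law mE mVA Eind _ _ mC).
  move=> D mD.
  rewrite [RHS](eq_bigr (fun i => Q ((fun w => row i (V w)) @^-1`
      [set v | D i (v *m A^T)]))).
    rewrite -(standard_normal_rows_indep VN (fun i => mrowA _ (mD i))).
    by congr (Q _); apply: eq_bigcapr => i _; apply/seteqP; split => w /=;
      rewrite row_mul.
  by move=> i _; congr (Q _); apply/seteqP; split => w /=; rewrite row_mul.
move=> i D mD.
have mDT : measurable [set v : 'cV[R]_p | D v^T].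
  apply: (measurable_preimage _ mD); apply: measurable_trmx; exact: measurable_id.
have := multivariate_normal_law (EN i)
  (standard_normal_trmx (standard_normal_row i VN)) AA mDT.
rewrite (_ : _ @^-1` _ = (fun w => row i (E w)) @^-1` D).
  move=> ->; congr (Q _); apply/seteqP; split => w /=;
  by rewrite add0r trmx_mul trmxK row_mul.
by apply/seteqP; split => w /=; rewrite trmxK.
Qed.

(** With E1 represented as V A', the matrix M E1 has the law of (M V) A', and
    M V is again standard normal. *)
Lemma iid_normal_rows_semiorthogonal d1 (T1 : measurableType d1) d2
    (T2 : measurableType d2) (R : realType) (P1 : probability T1 R)
    (P2 : probability T2 R) q n p (M : 'M[R]_(q, n)) (Sigma A : 'M[R]_p)
    (E1 : T1 -> 'M[R]_(n, p)) (E2 : T2 -> 'M[R]_(q, p)) :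
  M *m M^T = 1%:M -> A *m A^T = Sigma ->
  measurable_fun setT E1 -> iid_normal_rows P1 E1 Sigma ->
  measurable_fun setT E2 -> iid_normal_rows P2 E2 Sigma ->
  forall C, measurable C -> P1 [set w | C (M *m E1 w)] = P2 (E2 @^-1` C).
Proof.
move=> MMT AA mE1 E1N mE2 E2N C mC.
have [d [T [Q [V VN]]]] := standard_normal_exists R n p.
have MVN := standard_normal_semiorthogonal MMT VN.
rewrite (iid_normal_rows_law mE2 E2N MVN AA mC).
have mMC : measurable [set U : 'M[R]_(n, p) | C (M *m U)].
  apply: (measurable_preimage _ mC); apply: measurable_mulmx; exact: measurable_id.
rewrite [LHS](iid_normal_rows_law mE1 E1N VN AA mMC).
by congr (Q _); apply/seteqP; split => w /=; rewrite mulmxA.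
Qed.

Lemma iid_normal_rows_col_mx d (T : measurableType d) (R : realType)
    (P : probability T R) q p (Z : T -> 'cV[R]_p) (m : 'cV[R]_p)
    (Y : T -> 'M[R]_(q, p)) (Sigma : 'M[R]_p) :
  measurable_fun setT Z -> multivariate_normal P Z m Sigma ->
  measurable_fun setT Y -> iid_normal_rows P Y Sigma -> independent P Y Z ->
  iid_normal_rows P (fun w => col_mx (Z w - m)^T (Y w) : 'M[R]_(1 + q, p)) Sigma.
Proof.
move=> mZ ZN mY [Yind YN] YZ.
have rowY i w : row (rshift 1 i) (col_mx (Z w - m)^T (Y w)) = row i (Y w).
  by rewrite rowKd.
have rowZ i w : row (lshift q i) (col_mx (Z w - m)^T (Y w)) = (Z w - m)^T.
  by rewrite rowKu; apply/rowP => j; rewrite mxE (ord1 i).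
split.
  move=> C mC; rewrite big_split_ord /= big_ord1.
  rewrite (eq_bigr (fun i => P ((fun w => row i (Y w)) @^-1` C (rshift 1 i)))); last first.
    by move=> i _; congr (P _); apply/seteqP; split => w /=; rewrite rowY.
  rewrite -Yind; last by move=> i; exact: mC.
  pose CZ := [set z : 'cV[R]_p | C (lshift q ord0) (z - m)^T].
  have mCZ : measurable CZ.
    apply: (measurable_preimage _ (mC _)); apply: measurable_trmx.
    under eq_fun do rewrite addrC; apply: measurable_addmx; exact: measurable_id.
  pose CY := \bigcap_(i in [set: 'I_q]) ((fun y : 'M[R]_(q, p) => row i y) @^-1` C (rshift 1 i)).
  have mCY : measurable CY.
    apply: fin_bigcap_measurable => // i _; apply: (measurable_preimage _ (mC _)).
    by apply: measurable_row; exact: measurable_id.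
  rewrite muleC.
  have := YZ _ _ mCY mCZ.
  rewrite (_ : Y @^-1` CY = \bigcap_(i in [set: 'I_q]) ((fun w => row i (Y w)) @^-1` C (rshift 1 i)))//.
  rewrite (_ : Z @^-1` CZ = (fun w => row (lshift q ord0)
      (col_mx (Z w - m)^T (Y w))) @^-1` C (lshift q ord0)); last first.
    by apply/seteqP; split => w /=; rewrite rowZ.
  move=> <-; congr (P _); apply/seteqP; split => w /=.
    move=> Cw; split.
      by move=> i _ /=; rewrite -rowY; exact: Cw.
    exact: Cw.
  move=> [CYw CZw] i _ /=; rewrite -[i]splitK; case: (fintype.split i) => k.
    by rewrite (ord1 k).
  by rewrite /= rowY; exact: CYw.
move=> i; rewrite -[i]splitK; case: (fintype.split i) => k /=.
  have [d' [T' [Q [W [A [WN AA ZE]]]]]] := ZN.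
  exists d', T', Q, W, A; split => // B mB.
  have mmB : measurable [set z : 'cV[R]_p | B (z - m)].
    apply: (measurable_preimage _ mB).
    under eq_fun do rewrite addrC; apply: measurable_addmx; exact: measurable_id.
  transitivity (P (Z @^-1` [set z : 'cV[R]_p | B (z - m)])).
    by congr (P _); apply/seteqP; split => w /=; rewrite rowZ trmxK.
  rewrite ZE//; congr (Q _); apply/seteqP; split => w /=;
  by rewrite add0r addrC addKr.
have [d' [T' [Q [W [A [WN AA YE]]]]]] := YN k.
exists d', T', Q, W, A; split => // B mB; rewrite -YE//.
by congr (P _); apply/seteqP; split => w /=; rewrite rowY.
Qed.

(** * Counting form of the test *)

(** In a nonincreasing sequence, the entries at least z form an initial
    segment. *)
Lemma nth_sorted_lt disp (T : orderType disp) (x0 z : T) (s : seq T) i :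
  sorted (fun x y => (y <= x)%O) s -> (i < size s)%N ->
  (nth x0 s i < z)%O = (count (fun x => (z <= x)%O) s <= i)%N.
Proof.
elim: s i => //= x s IH i xs; have xmin : all (fun y => (y <= x)%O) s.
  by apply: order_path_min xs => u v w /= uv wu; exact: le_trans wu uv.
have [zx|xz] := leP z x.
  case: i => [|i] /= iN; first by rewrite ltNge zx.
  by rewrite IH// (path_sorted xs).
rewrite (@eq_in_count _ _ pred0) ?count_pred0.
  case: i => [|i] /= iN; first by rewrite xz.
  rewrite (le_lt_trans _ xz)//; move/allP: xmin; apply; exact: mem_nth.
by move=> y /(allP xmin) yx /=; apply/negbTE; rewrite -ltNge (le_lt_trans yx).
Qed.

(** With m the integer part of alpha N: the m-th largest draw is below z iff
    fewer than m draws reach z. The conventions for m = 0 and m = N extend this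
    equivalence to the values for which there is no m-th largest draw. *)
Lemma upper_quantile_lt (R : realType) (alpha : R) N (draw : 'I_N.-1 -> \bar R)
    (z : R) : (0 < N)%N -> 0 <= alpha <= 1 ->
  (upper_quantile alpha draw < z%:E)%E
  = ((1 + #|[set i | (z%:E <= draw i)%E]%SET|)%:R / N%:R <= alpha).
Proof.
move=> N0 /andP[a0 a1].
set c := #|_|.
have cN : (c <= N.-1)%N by rewrite -[X in (_ <= X)%N]card_ord max_card.
rewrite ler_pdivrMr ?ltr0n// -truncn_ge_nat ?mulr_ge0//.
rewrite /upper_quantile; set m := Num.truncn _.
have mN : (m <= N)%N.
  rewrite -(ler_nat R) (@le_trans _ _ (alpha * N%:R))//; last by rewrite ler_piMl.
  by rewrite truncn_le mulr_ge0.
case: ifPn => [/eqP ->|m0]; first by rewrite ltNge leey.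
case: ifPn => [/eqP ->|mN'].
  by rewrite ltNyr add1n -[X in (_ < X)%N](prednK N0) ltnS cN.
have mNlt : (m.-1 < N.-1)%N.
  by rewrite -ltnS (prednK N0) prednK ?lt0n// ltn_neqAle mN'.
rewrite nth_sorted_lt; last 2 first.
- by apply: sort_sorted => x y /=; exact: le_total.
- by rewrite size_sort size_map size_enum_ord.
rewrite count_sort count_map.
rewrite (_ : count _ _ = c).
  by rewrite add1n -ltnS prednK// lt0n.
rewrite /c cardE size_filter enumT; apply: eq_count => i.
by rewrite /= inE.
Qed.

(** The index type is split as 1 + (N - 1) to single out the identity, so that
    the other elements correspond to the N - 1 draws. *)
Lemma finite_group_enum (R : realType) n (G : set 'M[R]_n) :
  finite_set G -> G 1%:M ->
  exists S : 'I_(1 + (cardset G).-1) -> 'M[R]_n,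
    [/\ S (lshift _ ord0) = 1%:M, forall i, G (S i), injective S,
        cardset G = (cardset G).-1.+1
      & forall A : set 'M[R]_n,
          cardset (G `&` A) = #|[set i | `[< A (S i) >]]%SET|].
Proof.
move=> finG G1.
have F1 : 1%:M \in fset_set G by rewrite in_fset_set// inE.
pose s := 1%:M :: rem 1%:M (fset_set G).
have sF : perm_eq (fset_set G) s by exact: perm_to_rem.
have us : uniq s by rewrite -(perm_uniq sF) fset_uniq.
have sizes : size s = cardset G by rewrite -(perm_size sF).
have ss : size s = (1 + (cardset G).-1)%N by rewrite -sizes.
pose S (i : 'I_(1 + (cardset G).-1)) := nth 1%:M s i.
have Slt (i : 'I_(1 + (cardset G).-1)) : (i < size s)%N by rewrite ss ltn_ord.
exists S; split => //.
- move=> i; have : S i \in fset_set G by rewrite (perm_mem sF) mem_nth.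
  by rewrite in_fset_set// inE.
- by move=> i j /eqP; rewrite nth_uniq// => /eqP/val_inj.
- by rewrite -{1}sizes ss.
move=> A; have finGA : finite_set (G `&` A) by exact: finite_setIl.
have -> : cardset (G `&` A) = size [seq x <- s | `[< A x >]].
  rewrite /cardset; apply/perm_size/uniq_perm => //.
  - by rewrite filter_uniq.
  - move=> x; rewrite in_fset_set// mem_filter -(perm_mem sF) in_fset_set//.
    by rewrite in_setI andbC; congr andb.
have -> : s = [seq S i | i <- enum 'I_(1 + (cardset G).-1)].
  apply: (@eq_from_nth _ 1%:M); first by rewrite size_map size_enum_ord.
  move=> i; rewrite ss => iN; rewrite (nth_map (Ordinal iN)) ?size_enum_ord//.
  by rewrite /S nth_enum_ord.
rewrite filter_map size_map cardE size_filter size_filter enumT.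
by apply: eq_count => i; rewrite /= inE.
Qed.

(** * Power of the test *)

(** Row 0 of U plays the part of Z, and the other rows that of Y. *)
Definition exceeds_quantile (R : realType) (alpha : R) N p
    (U : 'M[R]_(1 + N.-1, p)) (j : 'I_p) : bool :=
  (upper_quantile alpha (N := N)
     (fun i => \big[maxe/-oo]_(l < p) (U (rshift 1 i) l)%:E)
   < (U (lshift N.-1 ord0) j)%:E)%E.

Lemma le_bigmaxe (R : realType) p (z : R) (f : 'I_p -> R) :
  (z%:E <= \big[maxe/-oo]_(l < p) (f l)%:E)%E <-> exists l, z <= f l.
Proof.
split=> [/bigmax_geP[|[l _ zl]]|[l zl]].
- by rewrite leeNy_eq.
- by exists l; rewrite -lee_fin.
- by apply/bigmax_geP; right; exists l; rewrite ?lee_fin.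
Qed.

(** In its counting form the event is a sublevel set of a sum of indicators. *)
Lemma measurable_exceeds_quantile (R : realType) (alpha : R) N p (j : 'I_p) :
  (0 < N)%N -> 0 <= alpha <= 1 ->
  measurable [set U : 'M[R]_(1 + N.-1, p) | exceeds_quantile alpha U j].
Proof.
move=> N0 a01.
pose A i := [set U : 'M[R]_(1 + N.-1, p) |
  ((U (lshift N.-1 ord0) j)%:E
    <= \big[maxe/-oo]_(l < p) (U (rshift 1 i) l)%:E)%E].
have mA i : measurable (A i).
  rewrite (_ : A i = \bigcup_(l in [set: 'I_p])
      ((fun U : 'M[R]_(1 + N.-1, p) => U (rshift 1 i) l - U (lshift N.-1 ord0) j)
       @^-1` `[0, +oo[%classic)).
    apply: fin_bigcup_measurable => // l _; apply: measurable_preimage => //.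
    by apply: measurable_funB; exact: measurable_mx_coord.
  apply/seteqP; split => U.
    by move=> /le_bigmaxe[l Ul]; exists l => //=; rewrite in_itv/= andbT subr_ge0.
  by move=> [l _]; rewrite /= in_itv/= andbT subr_ge0 => Ul; apply/le_bigmaxe; exists l.
pose count (U : 'M[R]_(1 + N.-1, p)) : R := \sum_(i < N.-1) \1_(A i) U.
rewrite (_ : [set _ | _] = (fun U => (1 + count U) / N%:R) @^-1` `]-oo, alpha]%classic).
  apply: measurable_preimage => //; apply: measurable_funM => //.
  apply: measurable_funD => //; apply: measurable_sum => i.
  exact: measurable_indic.
suff countE (U : 'M[R]_(1 + N.-1, p)) : (#|[set i | ((U (lshift N.-1 ord0) j)%:E
    <= \big[maxe/-oo]_(l < p) (U (rshift 1 i) l)%:E)%E]%SET|)%:R = count U.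
  by apply/seteqP; split => U /=;
    rewrite /exceeds_quantile upper_quantile_lt// in_itv/= natrD countE.
rewrite -sum1_card natr_sum big_mkcond /=; apply: eq_bigr => i _.
rewrite inE indicE; case: ifPn => Ui; first by rewrite mem_set.
by rewrite memNset//; exact/negP.
Qed.

Unset Implicit Arguments.

Theorem theorem3 (R : realType) (n p k : nat)
  (iota : 'cV[R]_n) (iota_unit : (iota^T *m iota) 0 0 = 1)
  (Sigma : 'M[R]_p) (Sigma_cov : covariance_matrix Sigma)
  (G : set 'M[R]_n) (G_oracle : oracle_subgroup iota G)
  (mu : 'cV[R]_p)
  (k_ge1 : (1 <= k)%N)
  (mu_pos : #|[set j : 'I_p | 0 < mu j 0]%SET| = k)
  (mu_rest : forall j, ~ (0 < mu j 0) -> mu j 0 = 0)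
  (alpha : R) (alpha01 : 0 <= alpha <= 1)
  (* the data X = sqrt n iota mu' + E *)
  (d : measure_display) (T : measurableType d) (P : probability T R)
  (E : {RV P >-> 'M[R]_(n, p)}) (E_normal : iid_normal_rows P E Sigma)
  (X : T -> 'M[R]_(n, p))
  (X_def : forall w, X w = Num.sqrt n%:R *: (iota *m mu^T) + E w)
  (* Z and the |G| - 1 rows of Y *)
  (d' : measure_display) (T' : measurableType d') (P' : probability T' R)
  (Z : {RV P' >-> 'cV[R]_p})
  (Z_normal : multivariate_normal P' Z (Num.sqrt n%:R *: mu) Sigma)
  (Y : {RV P' >-> 'M[R]_((cardset G).-1, p)})
  (Y_normal : iid_normal_rows P' Y Sigma)
  (YZ_indep : independent P' Y Z) :
  maxT_power P iota G alpha mu X =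
  ((k%:R^-1)%:E *
   \sum_(j < p | (0 < mu j 0)%R)
     P' [set w | (upper_quantile alpha (N := cardset G)
                    (fun i => \big[maxe/-oo]_(l < p) (Y w i l)%:E)
                  < (Z w j 0)%:E)%E])%E.
Proof.
have finG := oracle_subgroup_finite iota_unit G_oracle.
have [orthG [G1 mulG trG] _ oracleG] := G_oracle.
have [S [S0 SG Sinj cardG cardS]] := finite_group_enum finG G1.
set N := cardset G in S S0 SG Sinj cardG cardS Y Y_normal YZ_indep *.
have N0 : (0 < N)%N by rewrite cardG.
pose M : 'M[R]_(1 + N.-1, n) := \matrix_i (iota^T *m S i).
have MMT : M *m M^T = 1%:M.
  apply/matrixP => i j; rewrite !mxE.
  transitivity ((iota^T *m (S i *m (S j)^T) *m iota) 0 0).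
    have -> : iota^T *m (S i *m (S j)^T) *m iota
              = (iota^T *m S i) *m (iota^T *m S j)^T.
      by rewrite trmx_mul trmxK !mulmxA.
    rewrite [RHS]mxE; apply: eq_bigr => l _.
    by rewrite [M^T _ _]mxE ![M _ _]mxE [(iota^T *m S j)^T _ _]mxE.
  have [<-|ij] := eqVneq i j.
    by rewrite (mulmx1C (orthG _ (SG i))) mulmx1.
  apply: oracleG; first by apply: mulG => //; exact: trG.
  move=> Sij; move/eqP: ij; apply; apply: Sinj.
  by rewrite -[LHS]mulmx1 -(orthG _ (SG j)) mulmxA Sij mul1mx.
have Miota : M *m iota = delta_mx (lshift _ ord0) 0.
  apply/colP => i; rewrite !mxE andbT.
  transitivity ((iota^T *m S i *m iota) 0 0).
    by rewrite [RHS]mxE; apply: eq_bigr => l _; rewrite mxE.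
  have [->|i0] := eqVneq i (lshift _ ord0); first by rewrite S0 mulmx1.
  apply: oracleG; first exact: SG.
  by rewrite -S0 => /Sinj /eqP; rewrite (negbTE i0).
pose shift : 'M[R]_(1 + N.-1, p) :=
  Num.sqrt n%:R *: (delta_mx (lshift _ ord0) 0 *m mu^T).
have MX w : M *m X w = shift + M *m E w.
  by rewrite X_def mulmxDr -scalemxAr mulmxA Miota.
(* the identity always lies in the set counted by maxT_rejects, as the index
   j bounds the maximum below; it yields the summand 1 of upper_quantile_lt *)
have rejectE w j : maxT_rejects iota G alpha (X w) j <->
    exceeds_quantile alpha (M *m X w) j.
  have rowE i l : (iota^T *m S i *m X w) 0 l = (M *m X w) i l.
    by rewrite !mxE; apply: eq_bigr => a _; rewrite [M _ _]mxE.
  have iotaE l : (iota^T *m X w) 0 l = (M *m X w) (lshift _ ord0) l.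
    by rewrite -rowE S0 mulmx1.
  rewrite /maxT_rejects /exceeds_quantile upper_quantile_lt// /uniform_on cardS -/N.
  set c1 := #|_|; set c2 := #|_|.
  suff -> : c1 = (1 + c2)%N by [].
  rewrite /c1 /c2 -!sum1_card big_mkcond big_split_ord /= big_ord1 [in RHS]big_mkcond.
  rewrite inE /=; case: asboolP => [_|]; last first.
    case; apply/le_bigmaxe; exists j.
    by rewrite S0 mulmx1.
  congr (1 + _)%N; apply: eq_bigr => i _; rewrite !inE iotaE.
  under eq_bigr do rewrite rowE.
  by case: asboolP => [->//|/negP/negbTE ->].
have [dQ [TQ [Q [W [A [WN AA _]]]]]] := Z_normal.
have mZ : measurable_fun setT Z by exact: measurable_funPT.
have mY : measurable_fun setT Y by exact: measurable_funPT.
have mE : measurable_fun setT E by exact: measurable_funPT.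
pose stack w : 'M[R]_(1 + N.-1, p) := col_mx (Z w - Num.sqrt n%:R *: mu)^T (Y w).
have stackN : iid_normal_rows P' stack Sigma.
  exact: (iid_normal_rows_col_mx mZ Z_normal mY Y_normal YZ_indep).
have mstack : measurable_fun setT stack.
  apply: measurable_fun_mx => i j; rewrite -[i]splitK; case: (fintype.split i) => a /=.
    under eq_fun do rewrite col_mxEu; apply: measurable_fun_coord.
    apply: measurable_trmx; under eq_fun do rewrite addrC.
    exact: measurable_addmx.
  by under eq_fun do rewrite col_mxEd; exact: measurable_fun_coord.
have shift_stack w : shift + stack w = col_mx (Z w)^T (Y w).
  apply/matrixP => i j; rewrite -[i]splitK; case: (fintype.split i) => a /=.
    rewrite mxE !col_mxEu (ord1 a) /shift !mxE big_ord1 !mxE !eqxx mul1r.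
    by rewrite addrC subrK.
  rewrite mxE !col_mxEd /shift !mxE big_ord1 !mxE.
  by rewrite eq_rlshift mul0r mulr0 add0r.
have law := iid_normal_rows_semiorthogonal MMT AA mE E_normal mstack stackN.
rewrite /maxT_power.
(* maxT_power counts a classical set, mu_pos a finite one *)
have -> : #|([set j | 0 < mu j 0] : set 'I_p)| = k.
  by rewrite -mu_pos; apply: eq_card => j; rewrite inE; apply/asboolP/idP.
congr (_ * _)%E; apply: eq_bigr => j _.
have mD : measurable [set U | exceeds_quantile alpha (shift + U) j].
  apply: (measurable_preimage _ (measurable_exceeds_quantile j N0 alpha01)).
  by apply: measurable_addmx; exact: measurable_id.
transitivity (P [set w | exceeds_quantile alpha (shift + M *m E w) j]).
  by congr (P _); apply/seteqP; split => w /=; rewrite -MX => /rejectE.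
rewrite [LHS](law _ mD); congr (P' _).
have quantE w : exceeds_quantile alpha (shift + stack w) j =
    (upper_quantile alpha (N := cardset G)
       (fun i => \big[maxe/-oo]_(l < p) (Y w i l)%:E) < (Z w j 0)%:E)%E.
  rewrite /exceeds_quantile shift_stack col_mxEu mxE.
  congr (upper_quantile _ _ < _)%E; apply/funext => i.
  by apply: eq_bigr => l _; rewrite col_mxEd.
by apply/seteqP; split => w /=; rewrite quantE.
Qed.
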